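(* Let $\mathbb{X}$ be a Banach space with a basis. If $\ell_1$ is isomorphic to a complemented subspace of $\mathbb{X}$, then $\mathbb{X}$ has an almost greedy basis $\mathcal{B}_\kappa$ with fundamental function equivalent to $(m)_{m=1}^\infty$ and $L_m[\mathcal{B}_\kappa,\mathbb{X}]\approx\log m$ for $m\ge2$.
   Context: A basis $\mathcal{B}=(x_j)_{j=1}^\infty$ of a (real or complex) Banach space $\mathbb{X}$ is a Schauder basis, always assumed semi-normalized, i.e. $0<\inf_j\Vert x_j\Vert\le\sup_j\Vert x_j\Vert<\infty$; $(x_j^* )_{j=1}^\infty$ are its coordinate functionals. For $A\subseteq\mathbb{N}$, $S_A(f)=\sum_{j\in A}x_j^*(f)x_j$ (when well defined), and $\operatorname{supp}(f)=\{j: x_j^*(f)\ne0\}$. Define $$L_m[\mathcal{B},\mathbb{X}]=\sup\left\{\frac{\Vert S_A(f)\Vert}{\Vert f\Vert}: f\in\mathbb{X}\setminus\{0\},\ \max(\operatorname{supp}(f))\le m,\ A\subseteq\mathbb{N}\right\}.$$ The basis is almost greedy if there is a constant $C$ with $\Vert f-S_F(f)\Vert\le C\Vert f-S_A(f)\Vert$ whenever $f\in\mathbb{X}$, $|A|\le|F|<\infty$, and $|x_j^*(f)|\le|x_k^*(f)|$ for all $j\in\mathbb{N}\setminus F$, $k\in F$. Its fundamental function is $\varphi_m[\mathcal{B},\mathbb{X}]=\sup_{|A|\le m}\Vert\sum_{j\in A}x_j\Vert$, $m\in\mathbb{N}$. For families of non-negative numbers, $\alpha_i\lesssim\beta_i$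 means there is a constant $C$ with $\alpha_i\le C\beta_i$ for all $i$; $\alpha_i\approx\beta_i$ (equivalence) means $\alpha_i\lesssim\beta_i$ and $\beta_i\lesssim\alpha_i$. *)

(* Defs.v *)
From HB Require Import structures.
From mathcomp Require Import all_boot all_order all_algebra.
From mathcomp Require Import complex.
From mathcomp Require Import all_classical all_reals all_analysis.

Set Implicit Arguments.
Unset Strict Implicit.
Unset Printing Implicit Defensive.

Import Order.TTheory GRing.Theory Num.Theory.
Import numFieldNormedType.Exports.

Local Open Scope classical_set_scope.
Local Open Scope ring_scope.

(* [scalar_field R K] says that K is R or R[i]. A normedModType K has a
   K-valued norm; for K = R[i] its values are real and nonnegative, and
   [scalar_re] reads them in R, where suprema are available. *)
Inductive scalar_field (R : realType) : numFieldType -> Type :=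
| RealScalars : scalar_field R R
| ComplexScalars : scalar_field R R[i].

Definition scalar_re (R : realType) (K : numFieldType)
    (sk : scalar_field R K) : K -> R :=
  match sk in scalar_field _ K0 return K0 -> R with
  | RealScalars => fun t : R => t
  | ComplexScalars => fun z : R[i] => complex.Re z
  end.

Definition scalar_of_real (R : realType) (K : numFieldType)
    (sk : scalar_field R K) : R -> K :=
  match sk in scalar_field _ K0 return R -> K0 with
  | RealScalars => fun t : R => t
  | ComplexScalars => fun t : R => t%:C%C
  end.

Definition rnorm (R : realType) (K : numFieldType) (sk : scalar_field R K)
    (V : normedZmodType K) (v : V) : R := scalar_re sk `|v|.

Lemma rnormK (R : realType) (K : numFieldType) (sk : scalar_field R K)
  (V : normedZmodType K) (v : V) : scalar_of_real sk (rnorm sk v) = `|v|.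
Proof.
rewrite /rnorm; have : `|v| \is Num.real by apply: normr_real.
by case: _ / sk V v => //= V v vr; rewrite RRe_real.
Qed.

Lemma scalar_of_realK (R : realType) (K : numFieldType)
  (sk : scalar_field R K) : cancel (scalar_of_real sk) (scalar_re sk).
Proof. by case: _ / sk. Qed.

Lemma ler_scalar_of_real (R : realType) (K : numFieldType)
  (sk : scalar_field R K) (s t : R) :
  (scalar_of_real sk s <= scalar_of_real sk t) = (s <= t).
Proof. by case: _ / sk => //=; rewrite lecR. Qed.

Lemma scalar_of_realD (R : realType) (K : numFieldType)
  (sk : scalar_field R K) (s t : R) :
  scalar_of_real sk (s + t) = scalar_of_real sk s + scalar_of_real sk t.
Proof. by case: _ / sk => //=; rewrite rmorphD. Qed.

Lemma scalar_of_realM (R : realType) (K : numFieldType)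
  (sk : scalar_field R K) (s t : R) :
  scalar_of_real sk (s * t) = scalar_of_real sk s * scalar_of_real sk t.
Proof. by case: _ / sk => //=; rewrite rmorphM. Qed.

Lemma scalar_of_real0 (R : realType) (K : numFieldType)
  (sk : scalar_field R K) : scalar_of_real sk 0 = 0.
Proof. by case: _ / sk. Qed.

Section rnorm_theory.
Context (R : realType) (K : numFieldType) (sk : scalar_field R K).
Context (V : normedZmodType K).
Implicit Types v w : V.

Lemma rnorm_ge0 v : 0 <= rnorm sk v.
Proof. by rewrite -(ler_scalar_of_real sk) rnormK scalar_of_real0. Qed.

Lemma rnorm0 : rnorm sk (0 : V) = 0.
Proof. by rewrite /rnorm normr0 -(scalar_of_real0 sk) scalar_of_realK. Qed.

Lemma rnorm_eq0 v : rnorm sk v = 0 -> v = 0.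
Proof.
by move=> v0; apply/eqP; rewrite -normr_eq0 -(rnormK sk) v0 scalar_of_real0.
Qed.

Lemma ler_rnormD v w : rnorm sk (v + w) <= rnorm sk v + rnorm sk w.
Proof. by rewrite -(ler_scalar_of_real sk) scalar_of_realD !rnormK ler_normD. Qed.

End rnorm_theory.

Lemma rnormM (R : realType) (K : numFieldType) (sk : scalar_field R K)
  (s t : K) : rnorm sk (s * t) = rnorm sk s * rnorm sk t.
Proof.
by apply: (can_inj (scalar_of_realK sk)); rewrite scalar_of_realM !rnormK normrM.
Qed.

Section ell1.
Context (R : realType) (K : numFieldType) (sk : scalar_field R K).
Implicit Types a b : nat -> K.

Definition ell1_norm a : \bar R := (\sum_(0 <= j <oo) (rnorm sk (a j))%:E)%E.

Definition ell1_pred : {pred nat -> K} := [pred a | `[< (ell1_norm a < +oo)%E >]].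

Lemma ell1_norm_ge0 a : (0 <= ell1_norm a)%E.
Proof. by apply: nneseries_ge0 => j _ _; rewrite lee_fin rnorm_ge0. Qed.

Lemma ell1_normD a b : (ell1_norm (a + b)%R <= ell1_norm a + ell1_norm b)%E.
Proof.
rewrite /ell1_norm -nneseriesD => [|j _ _|j _ _]; rewrite ?lee_fin ?rnorm_ge0//.
apply: lee_nneseries => [j _ _|j _]; first by rewrite lee_fin rnorm_ge0.
by rewrite -EFinD lee_fin ler_rnormD.
Qed.

Lemma ell1_normZ (k : K) a :
  ell1_norm (k *: a)%R = ((rnorm sk k)%:E * ell1_norm a)%E.
Proof.
rewrite /ell1_norm -nneseriesZl => [|j _]; last by rewrite lee_fin rnorm_ge0.
by apply: eq_eseriesr => j _; rewrite -EFinM -rnormM.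
Qed.

Lemma ell1_norm_eq0 a : ell1_norm a = 0%E -> a = 0.
Proof.
move=> a0; apply/funext => j; apply: (@rnorm_eq0 _ _ sk).
apply/eqP; rewrite eq_le rnorm_ge0 andbT -lee_fin.
rewrite (_ : 0%:E = ell1_norm a)// /ell1_norm (nneseriesD1 (n := j))//; last first.
  by move=> i _; rewrite lee_fin rnorm_ge0.
by rewrite leeDl// nneseries_ge0// => i _ _; rewrite lee_fin rnorm_ge0.
Qed.

Lemma ell1_submod_closed : submod_closed ell1_pred.
Proof.
split=> [|k a b /asboolP aoo /asboolP boo]; apply/asboolP.
  rewrite /ell1_norm eseries0// => j _ _; by rewrite rnorm0.
apply: (le_lt_trans (ell1_normD _ _)); rewrite lte_add_pinfty// ell1_normZ.
by rewrite lte_mul_pinfty// lee_fin rnorm_ge0.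
Qed.

HB.instance Definition _ :=
  GRing.isSubmodClosed.Build K (nat -> K) ell1_pred ell1_submod_closed.

Record ell1 := Ell1 { ell1_val :> nat -> K; _ : ell1_val \in ell1_pred }.

HB.instance Definition _ := [isSub for ell1_val].
HB.instance Definition _ := [Choice of ell1 by <:].
HB.instance Definition _ := [SubChoice_isSubLmodule of ell1 by <:].

Definition ell1_scalar_norm (a : ell1) : K :=
  scalar_of_real sk (fine (ell1_norm a)).

Lemma ell1_fin_num (a : ell1) : ell1_norm a \is a fin_num.
Proof.
by rewrite ge0_fin_numE ?ell1_norm_ge0//; case: a => a /= /asboolP.
Qed.

Lemma ler_ell1_scalar_normD (a b : ell1) :
  ell1_scalar_norm (a + b) <= ell1_scalar_norm a + ell1_scalar_norm b.
Proof.
rewrite /ell1_scalar_norm -scalar_of_realD ler_scalar_of_real.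
rewrite -fineD ?ell1_fin_num// fine_le ?fin_numD ?ell1_fin_num//.
exact: ell1_normD.
Qed.

Lemma ell1_scalar_normZ (k : K) (a : ell1) :
  ell1_scalar_norm (k *: a) = `|k| * ell1_scalar_norm a.
Proof.
rewrite /ell1_scalar_norm -(rnormK sk) -scalar_of_realM.
by rewrite [ell1_norm _]ell1_normZ fineM// ell1_fin_num.
Qed.

Lemma ell1_scalar_norm_eq0 (a : ell1) : ell1_scalar_norm a = 0 -> a = 0.
Proof.
rewrite /ell1_scalar_norm -(scalar_of_real0 sk).
move/(can_inj (scalar_of_realK sk)) => a0; apply/val_inj/ell1_norm_eq0.
by rewrite -[LHS]fineK ?ell1_fin_num// a0.
Qed.

HB.instance Definition _ := @Lmodule_isNormed.Build K ell1 ell1_scalar_norm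
  ler_ell1_scalar_normD ell1_scalar_normZ ell1_scalar_norm_eq0.

End ell1.

(* Bounded two-sided estimates: T is a linear homeomorphism of E onto Y. *)
Definition isomorphic_onto (K : numFieldType) (E X : normedModType K)
    (Y : set X) : Prop :=
  exists T : {linear E -> X}, range T = Y /\
    exists c C : K, 0 < c /\ forall a : E, c * `|a| <= `|T a| <= C * `|a|.

Definition complemented (K : numFieldType) (X : normedModType K)
    (Y : set X) : Prop :=
  exists P : {linear X -> X},
    [/\ continuous P, (forall v, P (P v) = P v) & range P = Y].

(* Bases are indexed from 0: [x j] is the vector usually written x_{j+1}. *)
Section bases.
Context (R : realType) (K : numFieldType) (sk : scalar_field R K).
Context (X : normedModType K).
Implicit Types (x : nat -> X) (f : X) (A F : set nat).

Definition expansion x f (a : nat -> K) : Prop :=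
  series (fun j => a j *: x j) @ \oo --> f.

Definition schauder_basis x : Prop := forall f, exists! a, expansion x f a.

Definition semi_normalized x : Prop :=
  (0 < ereal_inf (range (fun j => (rnorm sk (x j))%:E)))%E /\
  (ereal_sup (range (fun j => (rnorm sk (x j))%:E)) < +oo)%E.

Definition banach_basis x : Prop := schauder_basis x /\ semi_normalized x.

Definition coordinate x (j : nat) f : K := get [set a | expansion x f a] j.

(* S_A(f). The sum is only used for A finite or f finitely supported
   ([\sum_(j \in A)] is 0 when it has infinitely many nonzero terms). *)
Definition coord_proj x A f : X := \sum_(j \in A) coordinate x j f *: x j.

Definition almost_greedy x : Prop :=
  exists C : R, forall f A F,
    finite_set F -> (A #<= F)%card ->
    (forall j k, ~ F j -> F k -> `|coordinate x j f| <= `|coordinate x k f|) ->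
    rnorm sk (f - coord_proj x F f) <= C * rnorm sk (f - coord_proj x A f).

Definition fundamental_function x (m : nat) : \bar R :=
  ereal_sup [set (rnorm sk (\sum_(j \in A) x j))%:E | A in [set A | (A #<= `I_m)%card]].

(* With indices starting at 0, max (supp f) <= m reads: supp f is in `I_m. *)
Definition lebesgue_type_L x (m : nat) : \bar R :=
  ereal_sup [set y | exists f A, [/\ f != 0,
    [set j | coordinate x j f != 0] `<=` `I_m &
    y = (rnorm sk (coord_proj x A f) / rnorm sk f)%:E]].

End bases.

Definition lesssim (R : realType) (D : set nat) (alpha beta : nat -> \bar R) :
  Prop := exists C : R, forall m, D m -> (alpha m <= C%:E * beta m)%E.

Definition equivalent_on (R : realType) (D : set nat)
    (alpha beta : nat -> \bar R) : Prop :=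
  lesssim D alpha beta /\ lesssim D beta alpha.

(* Main.v *)
From HB Require Import structures.
Require Import Defs.
From mathcomp Require Import all_boot all_order all_algebra.
From mathcomp Require Import complex finmap.
From mathcomp Require Import all_classical all_reals all_analysis.
From mathcomp Require Import zify ring lra.

Set Implicit Arguments.
Unset Strict Implicit.
Unset Printing Implicit Defensive.

Import Order.TTheory GRing.Theory Num.Theory.
Import numFieldNormedType.Exports.

Local Open Scope classical_set_scope.
Local Open Scope ring_scope.

(** The space X is isomorphic to X + l1 (direct sum), because a complemented
    copy of l1 can be cut into the spans of its even and of its odd unit
    vectors, and each of the two is again l1.  In [ell1_splitting] this takes
    the form of an embedding Phi of X into X, with a left inverse Psi, and of
    vectors q_j equivalent to the unit vectors of l1 which span a complement
    of the range of Phi.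

    Cut the indices into consecutive blocks, the n-th one of length 2^n, let
    v_n be the average of the q_j over the n-th block, and for a given basis
    x of X interlace the vectors Phi(x_k) with the differences v_k - v_(k-1).
    The result w is a basis of the sum of the range of Phi and of the closed
    span of the averages.
    The required basis, an instance of the method of Dilworth, Kalton and
    Kutzarova, is
      b_j = w_n + (q_j - v_n)     for j in the n-th block.
    Its j-th coefficient functional is the sum of two terms.  The first is
    the j-th functional of q minus its mean over the block, and the values of
    these functionals at a vector f form a sequence whose l1 norm is at most a
    constant times |f|.  The second is 2^-n times the n-th functional of w,
    and is therefore O(|f| / j).

    Over the whole n-th block, the terms of the expansion of f in b add up to
    the n-th term of its expansion in w plus a part of an absolutely convergent
    series in the deviations q_j - v_n; over a part of a block, the terms
    have norms adding up to O(|f|).  So the partial sums are bounded, and b is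
    a basis.

    The quantitative properties, except for one, follow from the decomposition
    of the coefficients.  They lie in weak l1 with norm O(|f|), whereas |f| is
    at most a constant times their l1 norm; so the fundamental function is
    equivalent to m, and L_m is at most of the order of the harmonic sum
    1 + 1/2 + ... + 1/m.  For greedy sums, fix a threshold t: beyond an index
    J = O(|f| / t) a coefficient of modulus at least t is dominated by its
    summable part, and the coefficients of modulus at most t and index below J
    have total modulus at most t J = O(|f|).  Hence a greedy sum of f differs
    from the partial sum of length J by a vector of norm O(|f|)
    ([near_ell1_greedy]); together with the weak l1 estimate this makes the
    basis almost greedy.

    The remaining property is that L_m is at least of the order of log m.  The
    bounded vector v_(n-1) is the sum of the n first differences, it is
    supported by the first 4^n indices, and keeping one difference out of two
    produces a vector of norm at least of the order of n, since the kept
    differences involve disjoint averages ([dkk_alternating]).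

    That a Schauder basis has uniformly bounded partial sums is not part of
    its definition; it comes from a Baire category argument
    ([schauder_partial_sums_bounded]).

    Scalars are real or complex, so norms are read in R through [rnorm] and
    limits are handled with real epsilons through [tends]. *)

(** * Real-valued norms and limits of sequences *)

Section RealNorm.
Context (R : realType) (K : numFieldType) (sk : scalar_field R K).
Local Notation N := (rnorm sk).

Lemma scalar_of_real_eq1 : scalar_of_real sk 1 = 1.
Proof. by case: _ / sk. Qed.

Lemma rnormZ (V : normedModType K) (k : K) (v : V) : N (k *: v) = N k * N v.
Proof.
by apply: (can_inj (scalar_of_realK sk)); rewrite scalar_of_realM !rnormK normrZ.
Qed.

Lemma rnormN (V : normedZmodType K) (v : V) : N (- v) = N v.
Proof. by rewrite /rnorm normrN. Qed.

Lemma rnorm_distC (V : normedZmodType K) (v w : V) : N (v - w) = N (w - v).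
Proof. by rewrite -rnormN opprB. Qed.

Lemma ler_rnormB (V : normedZmodType K) (v w : V) : N (v - w) <= N v + N w.
Proof. by apply: (le_trans (ler_rnormD _ _ _)); rewrite rnormN. Qed.

Lemma ler_rnorm_sum (V : normedZmodType K) I (r : seq I) (P : pred I)
    (F : I -> V) : N (\sum_(i <- r | P i) F i) <= \sum_(i <- r | P i) N (F i).
Proof.
elim/big_ind2: _ => [|x1 x2 y1 y2 le1 le2|//]; first by rewrite rnorm0.
exact: le_trans (ler_rnormD _ _ _) (lerD le1 le2).
Qed.

Lemma rnorm_gt0 (V : normedZmodType K) (v : V) : (0 < N v) = (v != 0).
Proof.
rewrite lt0r rnorm_ge0 andbT; apply/idP/idP; apply: contraNN => /eqP.
  by move=> ->; rewrite rnorm0.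
by move=> /rnorm_eq0 ->.
Qed.

Lemma rnorm1 : N (1 : K) = 1.
Proof. by rewrite /rnorm normr1 -scalar_of_real_eq1 scalar_of_realK. Qed.

Lemma rnormV (k : K) : k != 0 -> N k^-1 = (N k)^-1.
Proof.
move=> k0; have Nk : N k != 0 by rewrite gt_eqF ?rnorm_gt0.
by apply: (mulfI Nk); rewrite -rnormM !divff// rnorm1.
Qed.

Lemma rnorm_nat n : N (n%:R : K) = n%:R.
Proof.
rewrite /rnorm normr_nat; case: _ / sk => //=.
by elim: n => // n IH; rewrite -!natr1 raddfD /= IH.
Qed.

Lemma rnorm_of_real (t : R) : 0 <= t -> N (scalar_of_real sk t) = t.
Proof.
move=> t0; rewrite /rnorm ger0_norm ?scalar_of_realK//.
by rewrite -(scalar_of_real0 sk) ler_scalar_of_real.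
Qed.

Lemma ler_rnorm_norm (V W : normedZmodType K) (v : V) (w : W) :
  (`|v| <= `|w|) = (N v <= N w).
Proof. by rewrite -!(rnormK sk) ler_scalar_of_real. Qed.

Definition tends (V : normedZmodType K) (u : nat -> V) (l : V) : Prop :=
  forall e : R, 0 < e -> exists n0, forall n, (n0 <= n)%N -> N (u n - l) < e.

(** Stated through [rnorm], for the space as well as for its scalar field. *)
Definition norm_complete (V : normedZmodType K) : Prop := forall u : nat -> V,
  (forall e : R, 0 < e -> exists n0, forall m n, (n0 <= m)%N -> (n0 <= n)%N ->
     N (u m - u n) < e) -> exists l, tends u l.

Lemma ltr_scalar_of_real (s t : R) :
  (scalar_of_real sk s < scalar_of_real sk t) = (s < t).
Proof.
by rewrite !lt_neqAle ler_scalar_of_real (can_eq (scalar_of_realK sk)).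
Qed.

Lemma pos_scalar_of_real (e : K) : 0 < e ->
  exists2 t : R, 0 < t & e = scalar_of_real sk t.
Proof.
move=> e0; exists (N e); first by rewrite rnorm_gt0 gt_eqF.
by rewrite rnormK gtr0_norm.
Qed.

Lemma cvg_tends (V : normedModType K) (u : nat -> V) (l : V) :
  u @ \oo --> l <-> tends u l.
Proof.
rewrite cvgrPdistC_lt; split => [H e e0|H e /pos_scalar_of_real[t t0 ->]].
  have /H[n0 _ Hn0] : 0 < scalar_of_real sk e.
    by rewrite -(scalar_of_real0 sk) ltr_scalar_of_real.
  exists n0 => n n0n; rewrite -ltr_scalar_of_real rnormK; exact: Hn0.
have [n0 Hn0] := H _ t0; exists n0 => // n /= n0n.
by rewrite -(rnormK sk) ltr_scalar_of_real; exact: Hn0.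
Qed.

Lemma completeNormed_complete (V : completeNormedModType K) : norm_complete V.
Proof.
move=> u Cu; suff /cauchy_cvg : cauchy (u @ \oo).
  by move=> /cvg_ex[l /cvg_tends ul]; exists l.
apply: cauchy_exP => e /pos_scalar_of_real[t t0 ->].
have [n0 Hn0] := Cu _ t0; exists (u n0), n0 => // n /= n0n.
rewrite -ball_normE /= -(rnormK sk) ltr_scalar_of_real; exact: Hn0.
Qed.

Lemma tends_unique (V : normedZmodType K) (u : nat -> V) l l' :
  tends u l -> tends u l' -> l = l'.
Proof.
move=> ul ul'; apply/eqP; rewrite -subr_eq0; apply/eqP/(@rnorm_eq0 _ _ sk).
apply/eqP; rewrite eq_le rnorm_ge0 andbT; apply/ler_addgt0Pr => e e0.
have [|n1 H1] := ul (e / 2); first lra.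
have [|n2 H2] := ul' (e / 2); first lra.
have {}H1 := H1 _ (leq_maxl n1 n2); have {}H2 := H2 _ (leq_maxr n1 n2).
set n := maxn _ _ in H1 H2.
have := ler_rnormB (u n - l') (u n - l).
have -> : u n - l' - (u n - l) = l - l' by rewrite opprB addrC addrA subrK.
by move: H1 H2; lra.
Qed.

Lemma tends_le (V : normedZmodType K) (u : nat -> V) l (B : R) n1 :
  tends u l -> (forall n, (n1 <= n)%N -> N (u n) <= B) -> N l <= B.
Proof.
move=> ul uB; apply/ler_addgt0Pr => e /ul[n2 H2].
have {}H2 := H2 _ (leq_maxl n2 n1); have := uB _ (leq_maxr n2 n1).
set n := maxn _ _ in H2 *.
have := ler_rnormB (u n) (u n - l); rewrite opprB addrC subrK.
by move: H2; lra.
Qed.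

Lemma tendsD (V : normedZmodType K) (u v : nat -> V) l l' :
  tends u l -> tends v l' -> tends (fun n => u n + v n) (l + l').
Proof.
move=> ul vl e e0.
have [|n1 H1] := ul (e / 2); first lra.
have [|n2 H2] := vl (e / 2); first lra.
exists (maxn n1 n2) => n; rewrite geq_max => /andP[/H1 {}H1 /H2 {}H2].
rewrite opprD addrACA; apply: le_lt_trans (ler_rnormD _ _ _) _.
by move: H1 H2; lra.
Qed.

Lemma tends_lip (V W : normedZmodType K) (u : nat -> V) (w : nat -> W) l l' C :
  (forall n, N (w n - l') <= C * N (u n - l)) -> tends u l -> tends w l'.
Proof.
move=> H ul e e0; have C1 : 0 < `|C| + 1 by rewrite ltr_wpDl.
have [|n0 Hn] := ul (e / (`|C| + 1)); first by rewrite divr_gt0.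
exists n0 => n /Hn; rewrite ltr_pdivlMr// mulrC; apply: le_lt_trans.
apply: le_trans (H n) _; rewrite ler_wpM2r ?rnorm_ge0//.
by rewrite (le_trans (ler_norm _))// lerDl.
Qed.

Lemma tends_ext (V : normedZmodType K) (u v : nat -> V) l :
  u =1 v -> tends u l -> tends v l.
Proof. by move=> /funext ->. Qed.

Lemma tends_cst (V : normedZmodType K) (l : V) : tends (fun=> l) l.
Proof. by move=> e e0; exists 0 => n _; rewrite subrr rnorm0. Qed.

Lemma tends_bounded (V : normedZmodType K) (u : nat -> V) l :
  tends u l -> exists B : R, forall n, N (u n) <= B.
Proof.
move=> /(_ 1 ltr01)[n0 H]; exists (N l + 1 + \sum_(i < n0) N (u i)) => n.
have [n0n|nn0] := leqP n0 n.
  have := H _ n0n; have := ler_rnormD sk (u n - l) l; rewrite subrK.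
  have : 0 <= \sum_(i < n0) N (u i) by apply: sumr_ge0 => i _; apply: rnorm_ge0.
  by move: (N _) (N _) (N _) (\sum_(_ < _) _) => *; lra.
rewrite (bigD1 (Ordinal nn0))//= addrCA lerDl addr_ge0//.
  by rewrite addr_ge0 ?rnorm_ge0.
by apply: sumr_ge0 => i _; apply: rnorm_ge0.
Qed.

(** The partial sums of the bounds increase to their supremum, and past an
    index where they are within e of it, the terms add up to less than e. *)
Lemma absolute_convergence (V : normedZmodType K) (u : nat -> V) (a : nat -> R) B :
  norm_complete V -> (forall n, N (u n) <= a n) ->
  (forall n, \sum_(i < n) a i <= B) ->
  exists2 l, tends (fun n => \sum_(i < n) u i) l & N l <= B.
Proof.
move=> cV ua aB; have a0 n : 0 <= a n := le_trans (rnorm_ge0 _ _) (ua n).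
suff [l ul] : exists l, tends (fun n => \sum_(i < n) u i) l.
  exists l => //; apply: (@tends_le _ _ _ _ 0 ul) => n _.
  apply: le_trans (ler_rnorm_sum _ _ _) (le_trans _ (aB n)).
  exact: ler_sum.
apply: cV => e e0; pose S := [set \sum_(i < n) a i | n in setT].
have supS : has_sup S.
  by split; [exists 0, 0 => //; rewrite big_ord0 | exists B => _ [n _ <-]].
have [_ [n0 _ <-] Hn0] := sup_adherent e0 supS.
have mono m n : (m <= n)%N ->
    N (\sum_(i < n) u i - \sum_(i < m) u i) <= \sum_(i < n) a i - \sum_(i < m) a i.
  move=> mn; rewrite -!(big_mkord xpredT) !(big_cat_nat (leq0n m) mn) /=.
  rewrite !(addrC (\big[_/_]_(0 <= i < m) _)) !addrK.
  apply: le_trans (ler_rnorm_sum _ _ _) _; exact: ler_sum.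
have gen m n : (n0 <= m)%N -> (m <= n)%N ->
    N (\sum_(i < n) u i - \sum_(i < m) u i) < e.
  move=> n0m mn; apply: le_lt_trans (mono _ _ mn) _.
  have : \sum_(i < n) a i <= sup S by apply: sup_upper_bound => //; exists n.
  have : \sum_(i < n0) a i <= \sum_(i < m) a i.
    rewrite -subr_ge0; apply: le_trans (mono _ _ n0m); exact: rnorm_ge0.
  by move: Hn0; lra.
exists n0 => m n n0m n0n; case: (leqP m n) => [|/ltnW] mn; last exact: gen.
by rewrite rnorm_distC; exact: gen.
Qed.

End RealNorm.

Lemma hypot_le (R : rcfType) (a b : R) :
  Num.sqrt (a ^+ 2 + b ^+ 2) <= `|a| + `|b|.
Proof.
have s0 : 0 <= `|a| + `|b| by rewrite addr_ge0.
have le2 : a ^+ 2 + b ^+ 2 <= (`|a| + `|b|) ^+ 2.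
  rewrite sqrrD !real_normK ?num_real// addrAC lerDl mulrn_wge0// mulr_ge0//.
by have := ler_wsqrtr le2; rewrite sqrtr_sqr (ger0_norm s0).
Qed.

(** For complex scalars, the real and the imaginary parts are Cauchy. *)
Lemma scalars_complete (R : realType) (K : numFieldType) (sk : scalar_field R K) :
  norm_complete sk K.
Proof.
case: K / sk.
  exact: (@completeNormed_complete R R (RealScalars R) R^o).
move=> u Cu.
have cplR (v : nat -> R) :
    (forall m n, `|v m - v n| <= rnorm (ComplexScalars R) (u m - u n)) ->
    exists l, tends (RealScalars R) v l.
  move=> vu; apply: (@completeNormed_complete R R (RealScalars R) R^o).
  move=> e /Cu[n0 H]; exists n0 => m n m0 n0'.
  exact: le_lt_trans (vu _ _) (H _ _ m0 n0').
have ReIm (z : R[i]) : rnorm (ComplexScalars R) z =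
    Num.sqrt (complex.Re z ^+ 2 + complex.Im z ^+ 2).
  by rewrite /rnorm normc_def.
have [n|x ux] := cplR (fun n => complex.Re (u n)).
  move=> k; rewrite -raddfB ReIm -sqrtr_sqr ler_sqrt ?lerDl ?sqr_ge0//.
  by rewrite addr_ge0 ?sqr_ge0.
have [n|y uy] := cplR (fun n => complex.Im (u n)).
  move=> k; rewrite -raddfB ReIm -sqrtr_sqr ler_sqrt ?lerDr ?sqr_ge0//.
  by rewrite addr_ge0 ?sqr_ge0.
exists (x +i* y)%C => e e0.
have [|n1 H1] := ux (e / 2); first lra.
have [|n2 H2] := uy (e / 2); first lra.
exists (maxn n1 n2) => n; rewrite geq_max => /andP[/H1 {}H1 /H2 {}H2].
apply: (@le_lt_trans _ _ (`|complex.Re (u n) - x| + `|complex.Im (u n) - y|)).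
  by rewrite ReIm !raddfB; exact: hypot_le.
by move: H1 H2; rewrite /rnorm /=; lra.
Qed.

(** * Baire category and the coordinates of a Schauder basis *)

Section FiniteSums.
Context (R : realType) (K : numFieldType) (sk : scalar_field R K).
Local Notation N := (rnorm sk).

Lemma tends_sum (V : normedZmodType K) n (u : nat -> nat -> V) (l : nat -> V) :
  (forall i, tends sk (u i) (l i)) ->
  tends sk (fun m => \sum_(i < n) u i m) (\sum_(i < n) l i).
Proof.
move=> ul; elim: n => [|n IH].
  by apply: (tends_ext (u := fun=> 0)) => [m|]; rewrite big_ord0//; apply: tends_cst.
apply: (tends_ext (u := fun m => \sum_(i < n) u i m + u n m)) => [m|].
  by rewrite big_ord_recr.
by rewrite big_ord_recr; apply: tendsD.
Qed.

Lemma tendsZ (V : normedModType K) (c : nat -> K) l (v : V) :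
  tends sk c l -> tends sk (fun m => c m *: v) (l *: v).
Proof. by apply: (tends_lip (C := N v)) => n; rewrite -scalerBl rnormZ mulrC. Qed.

Lemma tendsN (V : normedZmodType K) (u : nat -> V) l :
  tends sk u l -> tends sk (fun m => - u m) (- l).
Proof. by apply: (tends_lip (C := 1)) => n; rewrite -opprD rnormN mul1r. Qed.

Lemma geometric_sum (n : nat) : \sum_(i < n) (2^-1 : R) ^+ i = 2 - 2 * 2^-1 ^+ n.
Proof.
elim: n => [|n IH]; first by rewrite big_ord0 expr0; lra.
by rewrite big_ord_recr /= IH exprS; lra.
Qed.

Lemma inv_small (c e : R) : 0 <= c -> 0 < e -> exists n, c * n.+1%:R^-1 < e :> R.
Proof.
move=> c0 e0; exists (Num.truncn (c / e)).
rewrite ltr_pdivrMr// mulrC -ltr_pdivrMr//; exact: truncnS_gt.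
Qed.

Lemma half_exp_le n : (2^-1 : R) ^+ n <= n.+1%:R^-1.
Proof.
by rewrite exprVn lef_pV2 ?posrE// -?natrX ?ltr0n ?expn_gt0// ler_nat ltn_expl.
Qed.

Lemma half_exp_small (c e : R) : 0 <= c -> 0 < e -> exists n, c * 2^-1 ^+ n < e.
Proof.
move=> c0 /(inv_small c0)[n H]; exists n; apply: le_lt_trans H.
by rewrite ler_wpM2l// half_exp_le.
Qed.

(** If no set [E k] were dense in any ball, one could choose nested balls, the
    (k+1)-st one at positive distance from [E k] and of radius at most
    1/(k+1); their common point would lie in no [E k]. *)
Lemma baire_category (V : normedModType K) (E : nat -> set V) :
  norm_complete sk V -> (forall f, exists k, E k f) ->
  exists k f0 r, 0 < r /\ forall g, N (g - f0) < r ->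
    forall e, 0 < e -> exists2 h, E k h & N (g - h) < e.
Proof.
move=> cV covE; apply: contrapT => noball.
have step (kp : nat * (V * R)) : exists p' : V * R, 0 < kp.2.2 ->
    [/\ 0 < p'.2, p'.2 <= kp.1.+1%:R^-1, N (p'.1 - kp.2.1) + p'.2 <= kp.2.2 &
        forall h, E kp.1 h -> p'.2 < N (p'.1 - h)].
  case: kp => k [f0 r] /=; have [r0|] := ltP 0 r; last by exists (0, 0).
  apply: contrapT => none; apply: noball; exists k, f0, r; split=> // g gf e e0.
  apply: contrapT => noh; apply: none.
  exists (g, Num.min (e / 2) (Num.min k.+1%:R^-1 (r - N (g - f0)))) => _ /=; split.
  - by rewrite !lt_min divr_gt0 ?invr_gt0 ?ltr0n ?subr_gt0.
  - by rewrite !ge_min lexx orbT.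
  - by rewrite addrC -lerBrDr !ge_min lexx !orbT.
  - move=> h Eh; rewrite ltNge; apply/negP; rewrite !le_min => /andP[he _].
    apply: noh; exists h => //; lra.
have [F HF] := choice step.
pose s := fix s n := if n is m.+1 then F (m, s m) else (0 : V, 1 : R).
have s_gt0 n : 0 < (s n).2 by elim: n => [|n IH] //=; have [] := HF (n, s n) IH.
have s_step n : [/\ (s n.+1).2 <= n.+1%:R^-1,
    N ((s n.+1).1 - (s n).1) + (s n.+1).2 <= (s n).2 &
    forall h, E n h -> (s n.+1).2 < N ((s n.+1).1 - h)].
  by have [] := HF (n, s n) (s_gt0 n).
have s_dist n m : (n <= m)%N -> N ((s m).1 - (s n).1) + (s m).2 <= (s n).2.
  elim: m => [|m IH]; first by rewrite leqn0 => /eqP ->; rewrite subrr rnorm0 add0r.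
  rewrite leq_eqVlt => /predU1P[->|/IH]; first by rewrite subrr rnorm0 add0r.
  have [_ + _] := s_step m.
  have := ler_rnormD sk ((s m.+1).1 - (s m).1) ((s m).1 - (s n).1).
  by rewrite subrKA; lra.
have [|l sl] := cV (fun n => (s n).1).
  move=> e e0; have [|n ne] := @inv_small 2 e _ e0; first lra.
  have [sn _ _] := s_step n.
  exists n.+1 => m p nm np; have := s_dist _ _ nm; have := s_dist _ _ np.
  have := s_gt0 m; have := s_gt0 p.
  have := ler_rnormB sk ((s m).1 - (s n.+1).1) ((s p).1 - (s n.+1).1).
  have -> : (s m).1 - (s n.+1).1 - ((s p).1 - (s n.+1).1) = (s m).1 - (s p).1.
    by rewrite opprB addrA subrK.
  by move: ne sn; move: (n.+1%:R^-1) => q; lra.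
have ls n : N ((s n).1 - l) <= (s n).2.
  apply: (@tends_le _ _ _ _ (fun m => (s n).1 - (s m).1) _ _ n).
    by apply: tendsD; [exact: tends_cst|exact: tendsN].
  move=> m nm; rewrite rnorm_distC; have := s_dist _ _ nm; have := s_gt0 m; lra.
have [k Ek] := covE l.
have [_ _ /(_ _ Ek)] := s_step k; rewrite ltNge => /negP; apply.
exact: (ls k.+1).
Qed.

End FiniteSums.

Section Schauder.
Context (R : realType) (K : numFieldType) (sk : scalar_field R K).
Context (X : normedModType K).
Local Notation N := (rnorm sk).

Lemma expansion_tends (x : nat -> X) f a :
  expansion x f a <-> tends sk (fun n => \sum_(i < n) a i *: x i) f.
Proof.
rewrite /expansion (cvg_tends sk) /series /=.
by split; apply: tends_ext => n; rewrite big_mkord.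
Qed.

Context (x : nat -> X) (sx : schauder_basis x).

Lemma coordinate_expansion f : expansion x f (fun j => coordinate x j f).
Proof.
have [a [fa _]] := sx f; rewrite /coordinate.
have := getPex _ : expansion x f (get [set a | expansion x f a]).
by apply; exists a.
Qed.

Lemma coordinate_unique f a : expansion x f a -> forall j, coordinate x j f = a j.
Proof.
move=> fa j; have [b [_ bu]] := sx f.
by rewrite -(bu _ fa) (bu _ (@coordinate_expansion f)).
Qed.

Lemma coordinate_linear j : scalar (coordinate x j).
Proof.
move=> k u v; pose a j := k * coordinate x j u + coordinate x j v.
rewrite (@coordinate_unique _ a)//; apply/expansion_tends.
apply: (@tends_ext _ _ _ _ (fun n => k *: (\sum_(i < n) coordinate x i u *: x i) +
    (\sum_(i < n) coordinate x i v *: x i))) => [n|].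
  rewrite scaler_sumr -big_split; apply: eq_bigr => i _.
  by rewrite /a scalerDl scalerA.
apply: tendsD; last exact/expansion_tends/coordinate_expansion.
have /expansion_tends := @coordinate_expansion u; apply: (tends_lip (C := N k)) => n.
by rewrite -scalerBr rnormZ.
Qed.

End Schauder.

(** * Boundedness of the partial sums of a Schauder basis *)

Lemma sum_range (V : zmodType) (F : nat -> V) i m : (i <= m)%N ->
  \sum_(l < m) F l - \sum_(l < i) F l = \sum_(i <= l < m) F l.
Proof.
move=> im; rewrite -(big_mkord xpredT F) -(big_mkord xpredT F (n := i)).
by rewrite (big_cat_nat (leq0n i) im) /= [X in X - _]addrC addrK.
Qed.

Section ScalarMaps.
Context (K : numFieldType) (X : lmodType K).

Lemma scalar_map0 (phi : X -> K) : scalar phi -> phi 0 = 0.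
Proof.
move=> lphi; have := lphi 1 0 0; rewrite scaler0 mul1r addr0 => /eqP.
by rewrite -subr_eq0 opprD addNKr oppr_eq0 => /eqP.
Qed.

Lemma scalar_map_sum I (r : seq I) (phi : X -> K) (F : I -> X) : scalar phi ->
  phi (\sum_(i <- r) F i) = \sum_(i <- r) phi (F i).
Proof.
move=> lphi; elim: r => [|i r IH]; first by rewrite !big_nil scalar_map0.
rewrite !big_cons -IH.
by have := lphi 1 (F i) (\sum_(j <- r) F j); rewrite scale1r mul1r.
Qed.

Lemma scalar_mapB (phi : X -> K) u v : scalar phi -> phi (u - v) = phi u - phi v.
Proof. by move=> lphi; rewrite addrC -scaleN1r lphi mulN1r addrC. Qed.

Lemma scalar_mapZ (phi : X -> K) a u : scalar phi -> phi (a *: u) = a * phi u.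
Proof. by move=> lphi; rewrite -[a *: u]addr0 lphi scalar_map0// addr0. Qed.

Lemma scalar_mapD (phi : X -> K) u v : scalar phi -> phi (u + v) = phi u + phi v.
Proof. by move=> lphi; rewrite -[u]scale1r lphi mul1r scale1r. Qed.

Lemma linear_map_of (A : X -> X) : linear A -> exists B : {linear X -> X}, B =1 A.
Proof.
move=> linA.
pose B : {linear X -> X} := HB.pack A (GRing.isLinear.Build K X X *:%R A linA).
by exists B.
Qed.

End ScalarMaps.

Section PartialSums.
Context (R : realType) (K : numFieldType) (sk : scalar_field R K).
Context (X : completeNormedModType K).
Local Notation N := (rnorm sk).

(** The open mapping argument.  Let E k be the set of vectors whose partial sums
    are all bounded by k.  Some E k is dense in a ball, so, by differences and
    scaling, every f can be approximated arbitrarily well by a vector whose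
    partial sums are bounded by C |f|.  Correcting the error repeatedly, each
    time dividing it by two, writes f as a series of vectors g_i whose
    partial sums are bounded by C |f| / 2^i.  Their coefficients add up to
    coefficients of an expansion of f, which is the expansion of f by
    uniqueness. *)
Lemma schauder_partial_sums_bounded (x : nat -> X) :
  schauder_basis x -> (forall j, x j != 0) ->
  exists M : R, forall n f, N (\sum_(i < n) coordinate x i f *: x i) <= M * N f.
Proof.
move=> sx x0; pose S n f := \sum_(i < n) coordinate x i f *: x i.
have lin := coordinate_linear sk sx.
have SB n u v : S n (u - v) = S n u - S n v.
  rewrite /S -sumrB; apply: eq_bigr => i _; rewrite scalar_mapB ?scalerBl//.
have SZ n k u : S n (k *: u) = k *: S n u.
  by rewrite /S scaler_sumr; apply: eq_bigr => i _; rewrite scalar_mapZ ?scalerA.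
have Ssum n I (r : seq I) (u : I -> X) :
    S n (\sum_(l <- r) u l) = \sum_(l <- r) S n (u l).
  rewrite /S exchange_big; apply: eq_bigr => i _; rewrite scalar_map_sum//.
  by rewrite scaler_suml.
have Scvg f : tends sk (fun n => S n f) f.
  exact/(expansion_tends sk)/coordinate_expansion.
have Xc := @completeNormed_complete _ _ sk X.
have [|k [f0 [r [r0 dense0]]]] :=
  @baire_category _ _ sk X (fun k => [set f | forall n, N (S n f) <= k%:R]) Xc.
  move=> f; have [B SfB] := tends_bounded (Scvg f).
  exists (Num.truncn B).+1 => n; exact: le_trans (SfB n) (ltW (truncnS_gt _)).
pose C := 4 * k%:R / r; have C0 : 0 <= C by rewrite divr_ge0 ?mulr_ge0// ltW.
have approx f (e : R) : 0 < e -> exists h,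
    (forall n, N (S n h) <= C * N f) /\ N (f - h) < e.
  move=> e0; have [->|f0'] := eqVneq f 0.
    exists 0; rewrite subrr rnorm0 mulr0; split=> // n.
    by have := SB n 0 0; rewrite !subrr => ->; rewrite rnorm0.
  have Nf : 0 < N f by rewrite rnorm_gt0.
  pose s := r / (2 * N f); have s0 : 0 < s by rewrite divr_gt0 ?mulr_gt0.
  pose sg := scalar_of_real sk s; have Nsg : N sg = s by rewrite rnorm_of_real// ltW.
  have sg0 : sg != 0 by rewrite -(rnorm_gt0 sk) Nsg.
  have se0 : 0 < s * e / 2 by rewrite divr_gt0 // mulr_gt0.
  have [|h1 Eh1 h1e] := dense0 (sg *: f + f0) _ _ se0.
    rewrite addrK rnormZ Nsg /s invfM mulrA divfK ?gt_eqF//; move: r0; lra.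
  have [|h2 Eh2 h2e] := dense0 f0 _ _ se0; first by rewrite subrr rnorm0.
  exists (sg^-1 *: (h1 - h2)); split=> [n|].
    rewrite SZ rnormZ rnormV// Nsg SB.
    apply: (@le_trans _ _ (s^-1 * (k%:R + k%:R))).
      rewrite ler_wpM2l ?invr_ge0 ?(ltW s0)//.
      apply: le_trans (ler_rnormB sk _ _) (lerD _ _); [exact: Eh1|exact: Eh2].
    by rewrite /s /C invf_div le_eqVlt; apply/predU1l; field; exact: lt0r_neq0.
  have -> : f - sg^-1 *: (h1 - h2) = sg^-1 *: ((sg *: f + f0 - h1) - (f0 - h2)).
    rewrite -[f in LHS]scale1r -(mulVf sg0) -scalerA -scalerBr; congr (_ *: _).
    by rewrite !opprB [in RHS]addrAC addrACA subrr addr0 -addrA.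
  rewrite rnormZ rnormV// Nsg -(ltr_pM2l s0) mulrA divff ?gt_eqF// mul1r.
  apply: le_lt_trans (ler_rnormB sk _ _) _; move: h1e h2e; lra.
have [h Hh] : exists h : X -> R -> X, forall f (e : R), 0 < e ->
    (forall n, N (S n (h f e)) <= C * N f) /\ N (f - h f e) < e.
  have /choice[h Hh] : forall fe : X * R, exists h, 0 < fe.2 ->
      (forall n, N (S n h) <= C * N fe.1) /\ N (fe.1 - h) < fe.2.
    move=> [f e] /=; have [/(approx f)[h Hh]|_] := ltP 0 e; first by exists h.
    by exists 0.
  by exists (fun f e => h (f, e)) => f e /(Hh (f, e)).
exists (C * 2) => n0 f; have [->|f0'] := eqVneq f 0.
  have -> : \sum_(i < n0) coordinate x i 0 *: x i = 0.
    by have := SB n0 0 0; rewrite !subrr.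
  by rewrite rnorm0 mulr0.
have Nf : 0 < N f by rewrite rnorm_gt0.
pose geo i : R := 2^-1 ^+ i; have geo0 i : 0 < geo i by rewrite exprn_gt0 ?invr_gt0.
pose rho := fix rho i := if i is l.+1
  then rho l - h (rho l) (N f * geo l.+1) else f.
pose g i := h (rho i) (N f * geo i.+1).
have rhoS i : rho i.+1 = rho i - g i by [].
have rho_le i : N (rho i) <= N f * geo i.
  case: i => [|i]; first by rewrite /= /geo expr0 mulr1.
  by apply: ltW; have [|_] := Hh (rho i) (N f * geo i.+1); first exact: mulr_gt0.
have Sg n i : N (S n (g i)) <= C * N f * geo i.
  have [|+ _] := Hh (rho i) (N f * geo i.+1); first exact: mulr_gt0.
  by move=> /(_ n) /le_trans; apply; rewrite -mulrA ler_wpM2l.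
have sum_g m : \sum_(i < m) g i = f - rho m.
  elim: m => [|m IH]; first by rewrite big_ord0 subrr.
  by rewrite rhoS big_ord_recr /= IH opprB [g m - _]addrC addrA.
have sum_geo m : \sum_(i < m) C * N f * geo i <= C * 2 * N f.
  rewrite -mulr_sumr geometric_sum [leRHS]mulrAC ler_wpM2l//.
    by rewrite mulr_ge0// ltW.
  by rewrite gerBl mulr_ge0// ltW// geo0.
have coefs j : exists c, tends sk (fun m => \sum_(i < m) coordinate x j (g i)) c.
  have [|m|c cl _] := @absolute_convergence _ _ sk K
    (fun i => coordinate x j (g i)) (fun i => 2 * (N (x j))^-1 * (C * N f * geo i))
    (2 * (N (x j))^-1 * (C * 2 * N f)) (@scalars_complete R K sk).
  - move=> i; have Nx : 0 < N (x j) by rewrite rnorm_gt0.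
    rewrite mulrAC ler_pdivlMr// -rnormZ.
    have -> : coordinate x j (g i) *: x j = S j.+1 (g i) - S j (g i).
      by rewrite /S big_ord_recr /= addrC addrK.
    have := ler_rnormB sk (S j.+1 (g i)) (S j (g i)).
    by have := Sg j (i); have := Sg j.+1 i; lra.
  - rewrite -mulr_sumr ler_wpM2l// mulr_ge0 ?invr_ge0 ?rnorm_ge0//.
  - by exists c.
have {coefs} [b bl] := choice coefs.
pose T n := \sum_(i < n) b i *: x i.
have Tl n : tends sk (fun m => S n (\sum_(i < m) g i)) (T n).
  apply: (@tends_ext _ _ _ _ (fun m =>
    \sum_(i < n) (\sum_(l < m) coordinate x i (g l)) *: x i)).
    by move=> m; rewrite /S; apply: eq_bigr => i _; rewrite scalar_map_sum.
  apply: (@tends_sum _ _ _ _ n (fun i m => (\sum_(l < m) coordinate x i (g l)) *: x i)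
    (fun i => b i *: x i)).
  by move=> i; apply: tendsZ.
have Tle n : N (T n) <= C * 2 * N f.
  apply: (@tends_le _ _ _ _ _ _ _ 0%N (Tl n)) => m _; rewrite Ssum.
  apply: le_trans (ler_rnorm_sum _ _ _ _) _; apply: le_trans (sum_geo m).
  by apply: ler_sum => i _; apply: Sg.
have Ttail n i : N (T n - S n (f - rho i)) <= C * N f * 2 * geo i.
  apply: (@tends_le _ _ _ _ (fun m => S n (\sum_(l < m) g l) - S n (f - rho i)) _ _ i).
    by apply: tendsD => //; apply: tends_cst.
  move=> m im; rewrite -sum_g -SB.
  have -> : \sum_(l < m) g l - \sum_(l < i) g l = \sum_(i <= l < m) g l.
    exact: sum_range.
  rewrite Ssum; apply: le_trans (ler_rnorm_sum _ _ _ _) _.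
  apply: (@le_trans _ _ (\sum_(i <= l < m) C * N f * geo l)); first exact: ler_sum.
  have -> : \sum_(i <= l < m) C * N f * geo l = C * N f * (2 * geo i - 2 * geo m).
    rewrite -mulr_sumr -sum_range// !geometric_sum; congr (_ * _).
    by rewrite /geo; lra.
  have : 0 <= C * N f * geo m.
    exact: mulr_ge0 (mulr_ge0 C0 (rnorm_ge0 _ _)) (ltW (geo0 m)).
  by move: (geo i) (geo m) (C * N f) => *; lra.
have fb : expansion x f b.
  apply/(expansion_tends sk) => e e0; have e3 : 0 < e / 3 by lra.
  have [|i1 Hi1] := @half_exp_small R (C * N f * 2 + N f) _ _ e3.
    exact: addr_ge0 (mulr_ge0 (mulr_ge0 C0 (rnorm_ge0 _ _)) (ler0n _ 2)) (rnorm_ge0 _ _).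
  have [n1 Hn1] := Scvg (f - rho i1) _ e3.
  exists n1 => n /Hn1; have := Ttail n i1; have := rho_le i1.
  have := ler_rnormD sk (T n - S n (f - rho i1)) (S n (f - rho i1) - (f - rho i1)).
  rewrite subrKA; have := ler_rnormB sk (T n - (f - rho i1)) (rho i1).
  rewrite opprB addrA -[T n + rho i1 - f - rho i1]addrAC addrK.
  by move: Hi1; rewrite -/(geo i1) /T mulrDl; lra.
have -> : \sum_(i < n0) coordinate x i f *: x i = T n0; last exact: Tle.
by apply: eq_bigr => i _; rewrite (coordinate_unique sx fb).
Qed.


End PartialSums.

(** * Bases with coefficients close to summable *)

Lemma fsbig_ord_cond (V : nmodType) (A : set nat) m (F : nat -> V) :
  (forall j, A j -> (m <= j)%N -> F j = 0) ->
  \sum_(j \in A) F j = \sum_(j < m | (j : nat) \in A) F j.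
Proof.
move=> F0; rewrite [RHS]big_mkcond.
rewrite (fsbig_ord _ m (fun j => if j \in A then F j else 0)) -fsbig_mkcondr.
symmetry; apply: fsbig_widen => [j []//|j /= [Aj /not_andP[mj|//]]].
by apply: F0 => //; rewrite leqNgt; exact/negP.
Qed.

Lemma finite_set_bounded (A : set nat) : finite_set A -> exists m, A `<=` `I_m.
Proof.
move=> /finite_fsetP[Y ->]; exists (\max_(j <- enum_fset Y) j).+1 => j /= Yj.
by rewrite ltnS; apply: (leq_bigmax_seq (F := id)).
Qed.

Lemma card_set_count (A : set nat) m : A `<=` `I_m ->
  (A #= `I_(\sum_(j < m | (j : nat) \in A) 1))%card.
Proof.
move=> Am; pose s := [seq j <- iota 0 m | j \in A].
have As : A = [set` [fset j in s]%fset].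
  apply/seteqP; split=> j /=; rewrite !inE /= mem_filter mem_iota add0n.
    by move=> Aj; apply/andP; split; [exact/mem_set | exact: Am].
  by move=> /andP[/set_mem].
rewrite {1}As; apply/card_eq_fsetP.
rewrite card_fseq undup_id ?filter_uniq ?iota_uniq// size_filter -sum1_count.
by rewrite -(big_mkord (fun j => j \in A) (fun=> 1%N)) /index_iota subn0.
Qed.

Lemma card_le_count (A B : set nat) m : A `<=` `I_m -> B `<=` `I_m ->
  (A #<= B)%card ->
  (\sum_(j < m | (j : nat) \in A) 1 <= \sum_(j < m | (j : nat) \in B) 1)%N.
Proof.
move=> /card_set_count Am /card_set_count Bm.
by rewrite (card_le_eql Am) (card_le_eqr Bm) card_le_II.
Qed.

Lemma count_below m J : (\sum_(j < m | (j < J)%N) 1 <= J)%N.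
Proof.
suff -> : (\sum_(j < m | (j < J)%N) 1 = minn m J)%N by exact: geq_minr.
elim: m => [|m IH]; first by rewrite big_ord0 min0n.
by rewrite big_mkcond big_ord_recr -big_mkcond /= IH; case: ltnP => /=; lia.
Qed.

Lemma sum_count (R : pzSemiRingType) m (P : pred nat) (t : R) :
  \sum_(j < m | P j) t = (\sum_(j < m | P j) 1)%:R * t.
Proof. by rewrite natr_sum mulr_suml; apply: eq_bigr => j _; rewrite mul1r. Qed.

Lemma sum_below (R : numDomainType) m J (t : R) : 0 <= t ->
  \sum_(j < m | (j < J)%N) t <= J%:R * t.
Proof.
move=> t0; rewrite (sum_count _ (fun j => (j < J)%N)) ler_wpM2r// ler_nat.
exact: count_below.
Qed.

(** The hypothesis that matters is the splitting of [bs j f] into a summable part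
    [G j f] and an error O(|f| / j): since 1/j is just in weak l1, such
    coefficients have weak l1 norm O(|f|), and at each threshold t only O(|f| / t)
    of them are not governed by their summable part. *)
Section NearEll1.
Context (R : realType) (K : numFieldType) (sk : scalar_field R K).
Context (X : completeNormedModType K).
Local Notation N := (rnorm sk).
Context (b : nat -> X) (bs G : nat -> X -> K) (C : R).
Context (bs_scalar : forall j, scalar (bs j))
  (bs_b : forall i j, bs i (b j) = (i == j)%:R)
  (b_total : forall f (e : R), 0 < e ->
     exists n (c : nat -> K), N (f - \sum_(i < n) c i *: b i) < e)
  (b_sums : forall n f, N (\sum_(i < n) bs i f *: b i) <= C * N f)
  (b_le : forall j, N (b j) <= C)
  (G_ell1 : forall n f, \sum_(i < n) N (G i f) <= C * N f)
  (bs_near : forall j f, N (bs j f - G j f) <= C * N f / j.+1%:R).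

Let C0 : 0 <= C. Proof. exact: le_trans (rnorm_ge0 _ _) (b_le 0). Qed.

Lemma near_ell1_norm_gt0 j : 0 < N (b j).
Proof.
rewrite rnorm_gt0; apply/eqP => bj0; have := bs_b j j.
rewrite bj0 eqxx (scalar_map0 (bs_scalar j)).
by move/eqP; rewrite eq_sym oner_eq0.
Qed.

Lemma near_ell1_C_ge1 : 1 <= C.
Proof.
have := b_sums 1 (b 0); rewrite big_ord1 bs_b eqxx scale1r.
by rewrite ler_pMl ?near_ell1_norm_gt0.
Qed.

Lemma near_ell1_G_le j f : N (G j f) <= C * N f.
Proof.
apply: le_trans (G_ell1 j.+1 f); rewrite big_ord_recr /= lerDr.
by apply: sumr_ge0 => i _; apply: rnorm_ge0.
Qed.

Lemma near_ell1_bs_le j f : N (bs j f) <= 2 * C * N f.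
Proof.
have := ler_rnormD sk (bs j f - G j f) (G j f); rewrite subrK.
move=> /le_trans; apply; rewrite -mulrA mulr2n mulrDl mul1r.
apply: lerD (near_ell1_G_le j f); apply: le_trans (bs_near j f) _.
have CN : 0 <= C * N f by rewrite mulr_ge0 ?rnorm_ge0.
by rewrite ler_pdivrMr ?ltr0n// ler_peMr// ler1n.
Qed.

Lemma near_ell1_bs_sum n (c : nat -> K) j :
  bs j (\sum_(i < n) c i *: b i) = if (j < n)%N then c j else 0.
Proof.
rewrite scalar_map_sum//; under eq_bigr do rewrite scalar_mapZ// bs_b.
case: ifPn => jn.
  rewrite (bigD1 (Ordinal jn))//= eqxx mulr1 big1 ?addr0// => i ij.
  rewrite (_ : (j == i) = false) ?mulr0//.
  by apply: contraNF ij => /eqP ji; apply/eqP/val_inj.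
rewrite big1// => i _; rewrite (_ : (j == i) = false) ?mulr0//.
by apply: contraNF jn => /eqP ->.
Qed.

(** Partial sums of vectors of the span are eventually constant; density and
    uniform boundedness carry the convergence over to all vectors. *)
Lemma near_ell1_expansion f : expansion b f (fun j => bs j f).
Proof.
apply/(expansion_tends sk) => e e0.
have C1 : 0 < C + 1 by rewrite ltr_wpDl.
have [n [c gf]] := b_total f (divr_gt0 e0 C1).
set g := \sum_(i < n) _ in gf; exists n => m nm.
have -> : \sum_(i < m) bs i f *: b i - f =
    \sum_(i < m) bs i (f - g) *: b i - (f - g).
  have -> : \sum_(i < m) bs i (f - g) *: b i = \sum_(i < m) bs i f *: b i - g.
    under eq_bigr do rewrite scalar_mapB// scalerBl.
    rewrite sumrB; congr (_ - _).
    rewrite {2}/g (big_ord_widen _ (fun i => c i *: b i) nm) [RHS]big_mkcond /=.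
    apply: eq_bigr => i _; rewrite /g near_ell1_bs_sum.
    by case: ifP => //; rewrite scale0r.
  by rewrite opprB addrA subrK.
apply: le_lt_trans (ler_rnormB sk _ _) _; have := b_sums m (f - g).
move: gf; rewrite ltr_pdivlMr//; move: (N _) (N _) => *; nra.
Qed.

Lemma near_ell1_expansion_unique f a : expansion b f a -> forall j, a j = bs j f.
Proof.
move=> /(expansion_tends sk) fa j.
have : tends sk (fun n => bs j (\sum_(i < n) a i *: b i)) (bs j f).
  move: fa; apply: (tends_lip (C := 2 * C)) => n.
  by rewrite -scalar_mapB//; apply: near_ell1_bs_le.
apply: tends_unique => e e0; exists j.+1 => n jn.
by rewrite near_ell1_bs_sum jn subrr rnorm0.
Qed.

Lemma near_ell1_schauder : schauder_basis b.
Proof.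
move=> f; exists (fun j => bs j f); split; first exact: near_ell1_expansion.
by move=> a /near_ell1_expansion_unique fa; apply/funext => j.
Qed.

Lemma near_ell1_coordinate j f : coordinate b j f = bs j f.
Proof.
by rewrite (coordinate_unique near_ell1_schauder (@near_ell1_expansion f)).
Qed.

Lemma near_ell1_semi_normalized : semi_normalized sk b.
Proof.
have C2 : 0 < 2 * C by rewrite mulr_gt0// (lt_le_trans ltr01 near_ell1_C_ge1).
split; last first.
  apply: (@le_lt_trans _ _ C%:E); rewrite ?ltry//.
  by apply: ge_ereal_sup => _ [j _ <-]; rewrite lee_fin.
apply: (@lt_le_trans _ _ (2 * C)^-1%:E); first by rewrite lte_fin invr_gt0.
apply: le_ereal_inf_tmp => _ [j _ <-]; rewrite lee_fin.
have := near_ell1_bs_le j (b j); rewrite bs_b eqxx rnorm1.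
by rewrite -ler_pdivrMl// mulr1.
Qed.

(** Past the index J of the order of |h| / t, the error O(|h| / j) in the
    comparison of coefficients is at most t / 2. *)
Lemma near_ell1_threshold (t : R) h : 0 < t -> exists J : nat,
  J%:R * t <= 2 * C * N h /\ forall j, (J <= j)%N -> N (bs j h) <= N (G j h) + t / 2.
Proof.
move=> t0; pose D := 2 * C * N h / t.
have CN : 0 <= 2 * C * N h by rewrite !mulr_ge0 ?rnorm_ge0.
have D0 : 0 <= D by rewrite divr_ge0// ltW.
exists (Num.truncn D); split.
  by rewrite -ler_pdivlMr// truncn_le.
move=> j Jj; rewrite -lerBlDl.
apply: (@le_trans _ _ (N (bs j h - G j h))).
  by have := ler_rnormD sk (bs j h - G j h) (G j h); rewrite subrK lerBlDr.
apply: le_trans (bs_near j h) _; rewrite ler_pdivrMr ?ltr0n//.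
have : D <= j.+1%:R by apply: ltW; apply: lt_le_trans (truncnS_gt _) _; rewrite ler_nat.
rewrite /D ler_pdivrMr//; move: (j.+1%:R) => q; lra.
Qed.

(** There are at most J indices below J; at each later index of P the summable
    part is at least t / 2. *)
Lemma near_ell1_weak_type (t : R) h m (P : pred nat) : 0 < t ->
  (forall j, P j -> t <= N (bs j h)) ->
  t * (\sum_(j < m | P j) 1)%:R <= 4 * C * N h.
Proof.
move=> t0 Pt; have [J [Jt HJ]] := near_ell1_threshold h t0.
have pt (j : nat) :
    (if P j then t else 0) <= (if (j < J)%N then t else 0) + 2 * N (G j h).
  have g0 := rnorm_ge0 sk (G j h).
  case: ifPn => Pj; case: ltnP => jJ; move: t0 g0; try lra.
  by have := HJ _ jJ; have := Pt _ Pj; lra.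
rewrite natr_sum mulr_sumr big_mkcond /=.
apply: (@le_trans _ _ (\sum_(j < m) ((if (j < J)%N then t else 0) + 2 * N (G j h)))).
  by apply: ler_sum => j _; rewrite mulr1; exact: pt.
rewrite big_split /= -mulr_sumr -big_mkcond /=.
have := G_ell1 m h; have := sum_below m J (ltW t0).
move: Jt; lra.
Qed.

(** The sum over P is compared with the partial sum of length J.  They differ at
    indices below J outside P, where the coefficient is at most t, and at
    indices of P beyond J, where the coefficient is at most twice its summable
    part. *)
Lemma near_ell1_greedy (t : R) h m (P : pred nat) : 0 < t ->
  (forall j, P j -> (j < m)%N) ->
  (forall j, P j -> t <= N (bs j h)) -> (forall j, ~~ P j -> N (bs j h) <= t) ->
  N (\sum_(j < m | P j) bs j h *: b j) <= (C + 4 * C ^+ 2) * N h.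
Proof.
move=> t0 Pm Pt Pt'; have [J [Jt HJ]] := near_ell1_threshold h t0.
pose M := maxn m J; have mM : (m <= M)%N := leq_maxl _ _.
have JM : (J <= M)%N := leq_maxr _ _.
pose d j : X := (if P j then bs j h *: b j else 0) -
                (if (j < J)%N then bs j h *: b j else 0).
have -> : \sum_(j < m | P j) bs j h *: b j =
    \sum_(j < J) bs j h *: b j + \sum_(j < M) d j.
  rewrite /d sumrB -!big_mkcond /=.
  rewrite -(big_ord_widen _ (fun i => bs i h *: b i) JM) addrC subrK.
  rewrite (big_ord_widen_cond _ P (fun i => bs i h *: b i) mM).
  by apply: eq_bigl => i; case: (boolP (P i)) => //= /Pm.
have dle j : N (d j) <= C * ((if (j < J)%N then t else 0) + 2 * N (G j h)).
  have g0 := rnorm_ge0 sk (G j h); rewrite /d.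
  have bC : N (bs j h *: b j) <= C * N (bs j h).
    by rewrite rnormZ mulrC ler_wpM2r ?rnorm_ge0.
  case: ifPn => Pj; case: ltnP => jJ.
  - by rewrite subrr rnorm0 mulr_ge0// addr_ge0 ?mulr_ge0// ltW.
  - rewrite subr0; apply: le_trans bC _; rewrite ler_wpM2l//.
    by have := HJ _ jJ; have := Pt _ Pj; lra.
  - rewrite sub0r rnormN; apply: le_trans bC _; rewrite ler_wpM2l//.
    by have := Pt' _ Pj; lra.
  - by rewrite subrr rnorm0 mulr_ge0// add0r mulr_ge0.
apply: le_trans (ler_rnormD _ _ _) _; rewrite mulrDl; apply: lerD; first exact: b_sums.
apply: le_trans (ler_rnorm_sum _ _ _ _) _.
apply: (@le_trans _ _ (\sum_(j < M) C * ((if (j < J)%N then t else 0) + 2 * N (G j h)))).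
  by apply: ler_sum => j _; exact: dle.
rewrite -mulr_sumr big_split /= -mulr_sumr -big_mkcond /=.
rewrite [4 * _]mulrC -mulrA -mulrA ler_wpM2l//.
have := G_ell1 M h; have := sum_below M J (ltW t0).
move: Jt; lra.
Qed.

Lemma near_ell1_coord_proj (A : set nat) f m : A `<=` `I_m ->
  coord_proj b A f = \sum_(j < m | (j : nat) \in A) bs j f *: b j.
Proof.
move=> Am; rewrite /coord_proj (fsbig_ord_cond (m := m)) => [|j /Am /= jm]; last first.
  by rewrite leqNgt jm.
by apply: eq_bigr => j _; rewrite near_ell1_coordinate.
Qed.

Lemma near_ell1_bs_cond_sum (P : pred nat) m f j :
  bs j (\sum_(i < m | P i) bs i f *: b i) = if (j < m)%N && P j then bs j f else 0.
Proof.
rewrite big_mkcond.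
have -> : \sum_(i < m) (if P i then bs i f *: b i else 0) =
    \sum_(i < m) (if P i then bs i f else 0) *: b i.
  by apply: eq_bigr => i _; case: ifP => //; rewrite scale0r.
rewrite (near_ell1_bs_sum m (fun i => if P i then bs i f else 0)).
by case: ltnP.
Qed.

(** Put h = f - S_A(f).  Then f - S_F(f) is h minus its greedy sum over F \ A,
    plus the projection of f on A \ F.  The latter has norm at most C t times
    the number of elements of F \ A, which the weak type estimate for h bounds. *)
Lemma near_ell1_almost_greedy : almost_greedy sk b.
Proof.
exists (1 + (C + 4 * C ^+ 2) + 4 * C ^+ 2) => f A F finF AF FF.
have finA : finite_set A := card_le_finite AF finF.
have [mF Fm'] := finite_set_bounded finF; have [mA Am'] := finite_set_bounded finA.
pose m := maxn mF mA.
have Fm : F `<=` `I_m by move=> j /Fm' /= jm; rewrite leq_max jm.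
have Am : A `<=` `I_m by move=> j /Am' /= jm; rewrite leq_max jm orbT.
rewrite !(near_ell1_coord_proj _ Fm) !(near_ell1_coord_proj _ Am).
set SF := \sum_(j < m | _ \in F) _; set SA := \sum_(j < m | _ \in A) _.
pose h := f - SA.
have bsh j : bs j h = if j \in A then 0 else bs j f.
  rewrite /h scalar_mapB// (near_ell1_bs_cond_sum (fun i => i \in A)).
  case: (boolP (j \in A)) => /= jA.
    by rewrite (Am _ (set_mem jA) : (j < m)%N) subrr.
  by rewrite andbF subr0.
pose P := fun j : nat => (j \in F) && (j \notin A).
pose Q := fun j : nat => (j \in A) && (j \notin F).
have countPQ : (\sum_(j < m | Q j) 1 <= \sum_(j < m | P j) 1)%N.
  have := card_le_count Am Fm AF.
  rewrite [X in (X <= _)%N](bigID (fun j : 'I_m => (j : nat) \in F)) /=.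
  rewrite [X in (_ <= X)%N](bigID (fun j : 'I_m => (j : nat) \in A)) /=.
  by under [X in (_ <= X + _)%N]eq_bigl do rewrite andbC; rewrite leq_add2l.
have decomp : f - SF = h - \sum_(j < m | P j) bs j h *: b j +
                       \sum_(j < m | Q j) bs j f *: b j.
  have -> : \sum_(j < m | P j) bs j h *: b j = \sum_(j < m | P j) bs j f *: b j.
    by apply: eq_bigr => j /andP[_ /negbTE jA]; rewrite bsh jA.
  rewrite /h /SF /SA.
  rewrite (bigID (fun j : 'I_m => (j : nat) \in A)) /=.
  rewrite [X in _ = f - X - _ + _](bigID (fun j : 'I_m => (j : nat) \in F)) /=.
  under [X in _ = f - (X + _) - _ + _]eq_bigl do rewrite andbC.
  by rewrite !opprD !addrA [RHS]addrAC subrK.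
pose S := [set N (bs j f) | j in ~` F].
have supS : has_sup S.
  split; first by exists (N (bs m f)), m => //= /Fm /=; rewrite ltnn.
  by exists (2 * C * N f) => _ [j _ <-]; apply: near_ell1_bs_le.
(* This choice of t covers an empty F, where a minimum over F would not do. *)
pose t := sup S.
have tF j : F j -> t <= N (bs j f).
  move=> Fj; apply: ge_sup; first by case: supS.
  move=> _ [i Fi <-]; have := FF i j Fi Fj.
  by rewrite !near_ell1_coordinate (ler_rnorm_norm sk).
have tF' j : ~ F j -> N (bs j f) <= t.
  by move=> Fj; apply: sup_upper_bound => //; exists j.
have [t0|t0] := ltP 0 t; last first.
  have f0 j : ~ F j -> bs j f = 0.
    move=> /tF' jt; apply: (@rnorm_eq0 _ _ sk); apply/eqP.
    by rewrite eq_le rnorm_ge0 (le_trans jt t0).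
  have -> : f = SF.
    have /(expansion_tends sk) ff := @near_ell1_expansion f.
    apply: (tends_unique ff) => e e0.
    exists m => n mn; rewrite /SF.
    rewrite (big_ord_widen_cond _ (fun j => j \in F) (fun j => bs j f *: b j) mn).
    suff -> : \sum_(i < n) bs i f *: b i =
        \sum_(i < n | ((i : nat) \in F) && (i < m)%N) bs i f *: b i.
      by rewrite subrr rnorm0.
    rewrite [RHS]big_mkcond; apply: eq_bigr => i _; case: ifPn => // iF.
    rewrite f0 ?scale0r// => Fi; move: iF; rewrite (mem_set Fi) /=.
    by rewrite (Fm _ Fi : (i < m)%N).
  by rewrite subrr rnorm0 mulr_ge0 ?rnorm_ge0// !addr_ge0// ?mulr_ge0 ?exprn_ge0.
have Pm j : P j -> (j < m)%N by move=> /andP[/set_mem /Fm].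
have Pt j : P j -> t <= N (bs j h).
  by move=> /andP[jF /negbTE jA]; rewrite bsh jA tF//; exact: set_mem.
have Pt' j : ~~ P j -> N (bs j h) <= t.
  rewrite bsh negb_and negbK; case: ifP => /= jA; first by rewrite rnorm0 ltW.
  by rewrite orbF => jF; apply: tF' => /mem_set Fj; rewrite Fj in jF.
have := near_ell1_greedy t0 Pm Pt Pt'; have := near_ell1_weak_type m t0 Pt.
set SP := \sum_(j < m | P j) _ in decomp *; set SQ := \sum_(j < m | Q j) _ in decomp *.
have : N SQ <= C * (t * (\sum_(j < m | P j) 1)%:R).
  apply: le_trans (ler_rnorm_sum _ _ _ _) _.
  apply: (@le_trans _ _ (\sum_(j < m | Q j) C * t)).
    apply: ler_sum => j /andP[_ jF]; rewrite rnormZ mulrC ler_pM ?rnorm_ge0//.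
    by apply: tF' => /mem_set Fj; rewrite Fj in jF.
  rewrite -mulr_sumr ler_wpM2l// (sum_count _ Q) mulrC ler_wpM2l ?(ltW t0)//.
  by rewrite ler_nat.
rewrite decomp => SQle cle SPle.
apply: le_trans (ler_rnormD sk _ _) _; rewrite [leRHS]mulrDl; apply: lerD.
  apply: le_trans (ler_rnormB sk _ _) _.
  by rewrite mulrDl mul1r lerD2l.
apply: le_trans SQle _.
have -> : 4 * C ^+ 2 * N h = C * (4 * C * N h) by ring.
by rewrite ler_wpM2l.
Qed.

Lemma near_ell1_fundamental : equivalent_on [set m | (1 <= m)%N]
  (fundamental_function sk b) (fun m => (m%:R)%:E).
Proof.
split.
  exists C => m _; apply: ge_ereal_sup => _ [A Am <-].
  rewrite -EFinM lee_fin.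
  have finA := card_le_finite Am (finite_II m).
  have [M AM] := finite_set_bounded finA.
  have countA : (\sum_(j < M | (j : nat) \in A) 1 <= m)%N.
    by rewrite -card_le_II -(card_le_eql (card_set_count AM)).
  rewrite (fsbig_ord_cond (m := M)) => [|j /AM /= jM]; last by rewrite leqNgt jM.
  apply: le_trans (ler_rnorm_sum _ _ _ _) _.
  apply: (@le_trans _ _ (\sum_(j < M | (j : nat) \in A) C)); first exact: ler_sum.
  by rewrite (sum_count _ (fun j => j \in A)) mulrC ler_wpM2l// ler_nat.
exists (4 * C) => m _.
have le_m : m%:R <= 4 * C * N (\sum_(j < m) b j).
  have Pt j : (j < m)%N -> 1 <= N (bs j (\sum_(j < m) b j)).
    move=> jm; have := near_ell1_bs_sum m (fun=> 1) j.
    by under eq_bigr do rewrite scale1r; rewrite jm => ->; rewrite rnorm1.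
  have := near_ell1_weak_type m ltr01 Pt; rewrite mul1r.
  suff -> : (\sum_(j < m | (j < m)%N) 1 = m)%N by [].
  by rewrite (eq_bigl xpredT) ?sum1_card ?card_ord// => i; rewrite ltn_ord.
apply: (@le_trans _ _ ((4 * C)%:E * (N (\sum_(j < m) b j))%:E)%E).
  by rewrite -EFinM lee_fin.
rewrite lee_wpmul2l ?lee_fin ?mulr_ge0//.
apply: ereal_sup_ubound; exists `I_m; first exact: card_lexx.
by rewrite -fsbig_ord.
Qed.

Lemma harmonic_le m : \sum_(j < m.+1) (j.+1%:R : R)^-1 <= 1 + ln m.+1%:R.
Proof.
elim: m => [|m IH]; first by rewrite big_ord1 ln1 addr0 invr1.
rewrite big_ord_recr /=; apply: le_trans (lerD IH (lexx _)) _.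
rewrite -addrA lerD2l -lerBrDl.
have m2 : (0 : R) < m.+2%:R by rewrite ltr0n.
have : ln (1 + - (m.+2%:R : R)^-1) <= - (m.+2%:R)^-1.
  by apply: le_ln1Dx; rewrite ltrN2 invf_lt1// ltr1n.
have -> : 1 - (m.+2%:R : R)^-1 = m.+1%:R / m.+2%:R.
  have E : (m.+1%:R : R) = m.+2%:R - 1 by rewrite -[m.+2%:R]natr1 addrK.
  by rewrite [in RHS]E mulrBl divff ?mul1r// gt_eqF.
by rewrite ln_div ?posrE ?ltr0n// lerNr opprB.
Qed.

Lemma near_ell1_lebesgue_upper :
  lesssim [set m | (2 <= m)%N] (lebesgue_type_L sk b) (fun m => (ln m%:R)%:E).
Proof.
have ln2 : 0 < ln (2 : R) by rewrite ln_gt0// ltr1n.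
exists (C * (C * (2 + (ln (2 : R))^-1 * 2))) => m /= m2.
apply: ge_ereal_sup => _ [f [A [f0 fm ->]]]; rewrite -EFinM lee_fin.
rewrite ler_pdivrMr ?rnorm_gt0//.
have supp j : (m <= j)%N -> coordinate b j f = 0.
  by move=> mj; apply/eqP; apply: contraPT mj => /fm /=; rewrite ltnNge => /negP.
rewrite /coord_proj (fsbig_ord_cond (m := m)) => [|j _ /supp ->]; last by rewrite scale0r.
apply: le_trans (ler_rnorm_sum _ _ _ _) _; rewrite big_mkcond /=.
apply: (@le_trans _ _ (\sum_(j < m) C * (N (G j f) + C * N f * (j.+1%:R)^-1))).
  apply: ler_sum => j _; case: ifP => _; last first.
    by rewrite mulr_ge0// addr_ge0 ?rnorm_ge0// !mulr_ge0 ?rnorm_ge0// invr_ge0.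
  rewrite rnormZ near_ell1_coordinate mulrC ler_pM ?rnorm_ge0//.
  have := ler_rnormD sk (bs j f - G j f) (G j f); rewrite subrK.
  by move=> /le_trans; apply; rewrite addrC lerD2l; apply: bs_near.
rewrite -mulr_sumr.
apply: (@le_trans _ _ (C * (C * N f * (2 + ln m%:R)))).
  rewrite ler_wpM2l// big_split /= -mulr_sumr.
  have -> : C * N f * (2 + ln m%:R) = C * N f + C * N f * (1 + ln m%:R) by ring.
  apply: lerD; first exact: G_ell1.
  rewrite ler_wpM2l ?mulr_ge0 ?rnorm_ge0//.
  by case: m m2 {fm supp} => // m _; exact: harmonic_le.
have lm : ln 2 <= ln (m%:R : R).
  by rewrite ler_ln ?posrE ?ltr0n ?ler_nat//; apply: leq_trans m2.
have le1 : 1 <= (ln (2 : R))^-1 * ln m%:R by rewrite mulrC ler_pdivlMr// mul1r.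
have CN : 0 <= C * N f by rewrite mulr_ge0 ?rnorm_ge0.
set q := ln m%:R in lm le1 *; set a := (ln 2)^-1 in le1 *.
have -> : C * (C * (2 + a * 2)) * q * N f = C * (C * N f * ((2 + a * 2) * q)) by ring.
rewrite !ler_wpM2l//; move: le1 lm ln2; lra.
Qed.

(** The case of m < 4, where the vectors of the hypothesis do not help, is
    settled by L_m >= 1. *)
Lemma near_ell1_lebesgue_lower (c : R) : 0 < c ->
  (forall n, (0 < n)%N -> exists f (P : pred nat), [/\ f != 0,
     forall j, bs j f != 0 -> (j < 4 ^ n)%N &
     c * n%:R * N f <= N (\sum_(j < 4 ^ n | P j) bs j f *: b j)]) ->
  lesssim [set m | (2 <= m)%N] (fun m => (ln m%:R)%:E) (lebesgue_type_L sk b).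
Proof.
move=> c0 H; have ln4 : 0 < ln (4 : R) by rewrite ln_gt0// ltr1n.
exists (ln 4 * (1 + 2 / c)) => m /= m2.
have m0 : (0 < m)%N by apply: leq_trans m2.
have c2 : 0 <= 2 / c by rewrite divr_ge0// ltW.
set n := trunc_log 4 m.
have lnm : ln m%:R <= ln 4 * n.+1%:R :> R.
  rewrite mulr_natr -lnXn// -natrX ler_ln ?posrE ?ltr0n ?expn_gt0// ler_nat ltnW//.
  exact: trunc_log_ltn.
suff : (n.+1%:R%:E <= (1 + 2 / c)%:E * lebesgue_type_L sk b m)%E.
  move=> nL; apply: (@le_trans _ _ ((ln 4)%:E * n.+1%:R%:E)%E).
    by rewrite -EFinM lee_fin.
  by rewrite EFinM -muleA lee_wpmul2l// lee_fin ltW.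
have Lge f A : f != 0 -> [set j | bs j f != 0] `<=` `I_m ->
    ((N (coord_proj b A f) / N f)%:E <= lebesgue_type_L sk b m)%E.
  move=> f0 fm; apply: ereal_sup_ubound; exists f, A; split=> // j /=.
  by rewrite near_ell1_coordinate => /fm.
have [n0|n0] := posnP n.
  have b0 : b 0 != 0 by rewrite -(rnorm_gt0 sk) near_ell1_norm_gt0.
  have : (1%:E <= lebesgue_type_L sk b m)%E.
    have -> : 1 = N (coord_proj b `I_1 (b 0)) / N (b 0).
      rewrite (@near_ell1_coord_proj _ _ 1)//.
      rewrite big_mkcond big_ord1 /= mem_set// bs_b eqxx scale1r divff//.
      by rewrite gt_eqF// near_ell1_norm_gt0.
    apply: Lge => // j /=; rewrite bs_b; case: (j =P 0%N) => [->//|_].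
    by rewrite eqxx.
  rewrite n0 => L1; apply: (@le_trans _ _ ((1 + 2 / c)%:E * 1%:E)%E).
    by rewrite mule1 lee_fin lerDl.
  by rewrite lee_wpmul2l// lee_fin addr_ge0.
have [f [P [f0 fn fA]]] := H n n0.
pose A := [set j : nat | (j < 4 ^ n)%N && P j].
have projA : coord_proj b A f = \sum_(j < 4 ^ n | P j) bs j f *: b j.
  rewrite (@near_ell1_coord_proj _ _ (4 ^ n)) => [|j /= /andP[]//].
  apply: eq_bigl => j; apply/idP/idP => [/set_mem /andP[]//|Pj].
  by apply/mem_set; rewrite /A /= ltn_ord.
have cnL : ((c * n%:R)%:E <= lebesgue_type_L sk b m)%E.
  apply: le_trans (Lge f A f0 _).
    by rewrite lee_fin ler_pdivlMr ?rnorm_gt0// projA.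
  by move=> j /fn /= /leq_trans; apply; exact: trunc_logP.
apply: (@le_trans _ _ ((1 + 2 / c)%:E * (c * n%:R)%:E)%E); last first.
  by rewrite lee_wpmul2l// lee_fin addr_ge0.
rewrite -EFinM lee_fin mulrDl mul1r mulrA divfK ?gt_eqF// -natr1.
have : 1 <= n%:R :> R by rewrite ler1n.
have : 0 <= c * n%:R by rewrite mulr_ge0// ltW.
by lra.
Qed.

Lemma near_ell1_basis (c : R) : 0 < c ->
  (forall n, (0 < n)%N -> exists f (P : pred nat), [/\ f != 0,
     forall j, bs j f != 0 -> (j < 4 ^ n)%N &
     c * n%:R * N f <= N (\sum_(j < 4 ^ n | P j) bs j f *: b j)]) ->
  [/\ banach_basis sk b, almost_greedy sk b,
      equivalent_on [set m | (1 <= m)%N]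
        (fundamental_function sk b) (fun m => (m%:R)%:E) &
      equivalent_on [set m | (2 <= m)%N]
        (lebesgue_type_L sk b) (fun m => (ln m%:R)%:E)].
Proof.
move=> cgt0 H; split.
- by split; [exact: near_ell1_schauder | exact: near_ell1_semi_normalized].
- exact: near_ell1_almost_greedy.
- exact: near_ell1_fundamental.
- by split; [exact: near_ell1_lebesgue_upper | exact: near_ell1_lebesgue_lower cgt0 H].
Qed.
End NearEll1.

(** * Complemented copies of l1 *)

Section Ell1System.
Context (R : realType) (K : numFieldType) (sk : scalar_field R K).
Context (X : completeNormedModType K).
Local Notation N := (rnorm sk).

(** The functionals of an l1-system: f is mapped boundedly into l1. *)
Definition absolutely_summing (ts : nat -> X -> K) (M : R) : Prop :=
  (forall i, scalar (ts i)) /\ forall n f, \sum_(i < n) N (ts i f) <= M * N f.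

(** Up to the value of the constant, this says that t is equivalent to the unit
    vector basis of l1 and that its closed span is complemented by the
    projection mapping f to the sum of the ts i f *: t i. *)
Definition ell1_system (t : nat -> X) (ts : nat -> X -> K) (M : R) : Prop :=
  [/\ absolutely_summing ts M, forall i j, ts i (t j) = (i == j)%:R &
      forall i, N (t i) <= M].

Lemma summing_le ts M i f : absolutely_summing ts M -> N (ts i f) <= M * N f.
Proof.
move=> [_ /(_ i.+1 f)]; apply: le_trans; rewrite big_ord_recr /= lerDr.
by apply: sumr_ge0 => j _; apply: rnorm_ge0.
Qed.

Lemma bounded_tends (A : {linear X -> X}) (B : R) u l :
  (forall f, N (A f) <= B * N f) -> tends sk u l -> tends sk (fun n => A (u n)) (A l).
Proof. by move=> AB; apply: (tends_lip (C := B)) => n; rewrite -raddfB; exact: AB. Qed.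

Lemma scalar_tends (phi : X -> K) (B : R) u l : scalar phi ->
  (forall f, N (phi f) <= B * N f) -> tends sk u l ->
  tends sk (fun n => phi (u n)) (phi l).
Proof.
move=> lphi AB; apply: (tends_lip (C := B)) => n.
by rewrite -scalar_mapB//; exact: AB.
Qed.

(** Any bounded sequence y is the image of the unit vectors of l1 under a
    bounded operator; the operator obtained is its composition with the map
    of f to the sequence of the ts i f. *)
Lemma ell1_synthesis ts M (y : nat -> X) (B : R) :
  absolutely_summing ts M -> 0 <= B -> (forall i, N (y i) <= B) ->
  exists L : {linear X -> X},
    (forall u, tends sk (fun n => \sum_(i < n) ts i u *: y i) (L u)) /\
    (forall u, N (L u) <= M * B * N u).
Proof.
move=> [lts sumts] B0 yB.
have ex u : exists l, tends sk (fun n => \sum_(i < n) ts i u *: y i) l /\ N l <= M * B * N u.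
  have [|i|n|l ul lM] := @absolute_convergence _ _ sk X (fun i => ts i u *: y i)
    (fun i => N (ts i u) * B) (M * B * N u).
  - exact: completeNormed_complete.
  - by rewrite rnormZ ler_wpM2l ?rnorm_ge0.
  - by rewrite -mulr_suml mulrAC ler_wpM2r.
  by exists l.
have [L HL] := choice ex.
have linL : linear L.
  move=> a u v; have [Huv _] := HL (a *: u + v); apply: (tends_unique Huv).
  apply: (tends_ext (u := fun n =>
    a *: (\sum_(i < n) ts i u *: y i) + \sum_(i < n) ts i v *: y i)).
    move=> n; rewrite scaler_sumr -big_split; apply: eq_bigr => i _.
    by rewrite lts scalerDl scalerA.
  apply: tendsD; last by case: (HL v).
  have [Hu _] := HL u; apply: (tends_lip (C := N a)) Hu => n.
  by rewrite -scalerBr rnormZ.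
have [L' L'E] := linear_map_of linL; exists L'.
by split=> u; rewrite L'E; case: (HL u).
Qed.

Lemma synthesis_unique (ts ts' : nat -> X -> K) (y y' : nat -> X)
    (L L' : X -> X) (u v : X) :
  (forall u, tends sk (fun n => \sum_(i < n) ts i u *: y i) (L u)) ->
  (forall u, tends sk (fun n => \sum_(i < n) ts' i u *: y' i) (L' u)) ->
  (forall i, ts i u *: y i = ts' i v *: y' i) -> L u = L' v.
Proof.
move=> HL HL' e; apply: (tends_unique (HL u)); apply: (tends_ext _ (HL' v)) => n.
by apply: eq_bigr => i _.
Qed.

Lemma synthesis_comp (ts : nat -> X -> K) (y y' : nat -> X) (A : {linear X -> X})
    (L L' : X -> X) (B : R) u :
  (forall f, N (A f) <= B * N f) ->
  (forall u, tends sk (fun n => \sum_(i < n) ts i u *: y i) (L u)) ->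
  (forall u, tends sk (fun n => \sum_(i < n) ts i u *: y' i) (L' u)) ->
  (forall i, A (y i) = y' i) -> A (L u) = L' u.
Proof.
move=> AB HL HL' Ay; apply: (tends_unique (bounded_tends AB (HL u))).
apply: (tends_ext _ (HL' u)) => n; rewrite linear_sum; apply: eq_bigr => i _.
by rewrite linearZ_LR Ay.
Qed.

Lemma synthesis_eval (ts : nat -> X -> K) (y : nat -> X) (phi : X -> K)
    (L : X -> X) (B : R) u k :
  scalar phi -> (forall f, N (phi f) <= B * N f) ->
  (forall u, tends sk (fun n => \sum_(i < n) ts i u *: y i) (L u)) ->
  (forall i, phi (y i) = (i == k)%:R) -> phi (L u) = ts k u.
Proof.
move=> lphi phiB HL phiy.
apply: (tends_unique (scalar_tends lphi phiB (HL u))) => e e0; exists k.+1 => n kn.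
rewrite scalar_map_sum// (bigD1 (Ordinal kn))//= big1 => [|i ik].
  by rewrite scalar_mapZ// phiy eqxx mulr1 addr0 subrr rnorm0.
rewrite scalar_mapZ// phiy (_ : (_ == _) = false) ?mulr0//.
by apply: contraNF ik => /eqP ik; apply/eqP/val_inj.
Qed.

Lemma synthesis_eval0 (ts : nat -> X -> K) (y : nat -> X) (phi : X -> K)
    (L : X -> X) (B : R) u :
  scalar phi -> (forall f, N (phi f) <= B * N f) ->
  (forall u, tends sk (fun n => \sum_(i < n) ts i u *: y i) (L u)) ->
  (forall i, phi (y i) = 0) -> phi (L u) = 0.
Proof.
move=> lphi phiB HL phiy.
apply: (tends_unique (scalar_tends lphi phiB (HL u))) => e e0; exists 0%N => n _.
rewrite scalar_map_sum// big1 ?subrr ?rnorm0// => i _.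
by rewrite scalar_mapZ// phiy mulr0.
Qed.

Lemma synthesis_at (ts : nat -> X -> K) (y : nat -> X) (L : X -> X) u k :
  (forall u, tends sk (fun n => \sum_(i < n) ts i u *: y i) (L u)) ->
  (forall i, ts i u = (i == k)%:R) -> L u = y k.
Proof.
move=> HL tsu; apply: (tends_unique (HL u)) => e e0; exists k.+1 => n kn.
rewrite (bigD1 (Ordinal kn))//= big1 => [|i ik].
  by rewrite tsu eqxx scale1r addr0 subrr rnorm0.
rewrite tsu (_ : (_ == _) = false) ?scale0r//.
by apply: contraNF ik => /eqP ik; apply/eqP/val_inj.
Qed.

Lemma synthesis_at0 (ts : nat -> X -> K) (y : nat -> X) (L : X -> X) u :
  (forall u, tends sk (fun n => \sum_(i < n) ts i u *: y i) (L u)) ->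
  (forall i, ts i u = 0) -> L u = 0.
Proof.
move=> HL tsu; apply: (tends_unique (HL u)) => e e0; exists 0%N => n _.
by rewrite big1 ?subrr ?rnorm0// => i _; rewrite tsu scale0r.
Qed.

Lemma sum_even_odd (V : nmodType) (F : nat -> V) n :
  \sum_(i < n.*2) F i = \sum_(i < n) F i.*2 + \sum_(i < n) F i.*2.+1.
Proof.
elim: n => [|n IH]; first by rewrite !big_ord0 addr0.
by rewrite doubleS !big_ord_recr /= IH addrACA addrA.
Qed.

(** Let P be the projection on the closed span of t.  Let E and D vanish on its
    kernel, E sending t_i to t_2i, and D sending t_2i to t_i and the t_i of odd
    index to 0.  Then take Phi = 1 - P + E, Psi = 1 - P + D, and the t_i of odd
    index for q. *)
Lemma ell1_splitting t ts M : ell1_system t ts M ->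
  exists (Phi Psi : {linear X -> X}) (q : nat -> X) (qs : nat -> X -> K) (B : R),
    [/\ [/\ forall f, N (Phi f) <= B * N f & forall f, N (Psi f) <= B * N f],
        ell1_system q qs M,
        forall f, Psi (Phi f) = f,
        (forall i, Psi (q i) = 0) /\ (forall i f, qs i (Phi f) = 0) &
        forall f, tends sk (fun n => \sum_(i < n) qs i f *: q i) (f - Phi (Psi f))].
Proof.
move=> [sts tst tM]; have [lts sumts] := sts.
have M0 : 0 <= M := le_trans (rnorm_ge0 _ _) (tM 0%N).
pose te i := t i.*2; pose tse i := ts i.*2.
have evs : absolutely_summing tse M.
  split=> [i|n f]; first exact: lts.
  apply: le_trans (sumts n.*2 f); rewrite (sum_even_odd (fun i => N (ts i f))) lerDl.
  by apply: sumr_ge0 => i _; apply: rnorm_ge0.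
have ods : absolutely_summing (fun i => ts i.*2.+1) M.
  split=> [i|n f]; first exact: lts.
  apply: le_trans (sumts n.*2 f); rewrite (sum_even_odd (fun i => N (ts i f))) lerDr.
  by apply: sumr_ge0 => i _; apply: rnorm_ge0.
have [P [HP PB]] := ell1_synthesis sts M0 tM.
have [E [HE EB]] := ell1_synthesis (y := te) sts M0 (fun i => tM i.*2).
have [D [HD DB]] := ell1_synthesis evs M0 tM.
have [Q0 [HQ0 _]] := ell1_synthesis (y := te) evs M0 (fun i => tM i.*2).
have tsB i f := @summing_le _ _ i f sts.
have dbl_eq (i j : nat) : (i.*2 == j.*2) = (i == j) by apply/eqP/eqP => [/double_inj|->].
have tsP j f : ts j (P f) = ts j f.
  by apply: (synthesis_eval _ (lts j) (tsB j) HP) => i; rewrite tst eq_sym.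
have Pt k : P (t k) = t k by apply: (synthesis_at HP) => i; rewrite tst.
have PP f : P (P f) = P f by apply: (synthesis_comp _ PB HP HP).
have PE f : P (E f) = E f by apply: (synthesis_comp _ PB HE HE) => i; exact: Pt.
have PD f : P (D f) = D f by apply: (synthesis_comp _ PB HD HD) => i; exact: Pt.
have DE f : D (E f) = P f.
  apply: (synthesis_comp _ DB HE HP) => i; apply: (synthesis_at HD) => j.
  by rewrite /tse tst dbl_eq.
have DP f : D (P f) = D f by apply: (synthesis_unique HD HD) => i; rewrite /tse tsP.
have EP f : E (P f) = E f by apply: (synthesis_unique HE HE) => i; rewrite tsP.
have tsD j f : ts j (D f) = tse j f.
  by apply: (synthesis_eval _ (lts j) (tsB j) HD) => i; rewrite tst eq_sym.
have ED f : E (D f) = Q0 f by apply: (synthesis_unique HE HQ0) => i; rewrite /tse tsD.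
pose Phi : {linear X -> X} := (@idfun X \- P) \+ E.
pose Psi : {linear X -> X} := (@idfun X \- P) \+ D.
have PhiE f : Phi f = f - P f + E f by [].
have PsiE f : Psi f = f - P f + D f by [].
exists Phi, Psi, (fun i => t i.*2.+1), (fun i => ts i.*2.+1), (1 + M * M + M * M).
split.
- split=> f; rewrite ?PhiE ?PsiE !mulrDl mul1r; apply: le_trans (ler_rnormD sk _ _) _.
    by apply: lerD (EB f); apply: le_trans (ler_rnormB sk _ _) (lerD _ (PB f)).
  by apply: lerD (DB f); apply: le_trans (ler_rnormB sk _ _) (lerD _ (PB f)).
- split=> // i j; rewrite tst eqSS dbl_eq//.
- move=> f; rewrite PsiE PhiE (linearD P) (linearB P) (linearD D) (linearB D) PP PE DP DE.
  by rewrite !subrr !add0r addrK subrK.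
- split=> [i|i f].
    rewrite PsiE Pt subrr add0r; apply: (synthesis_at0 HD) => j.
    by rewrite /tse tst (_ : _ == _ = false)//; lia.
  rewrite PhiE scalar_mapD// scalar_mapB// tsP subrr add0r.
  apply: (synthesis_eval0 _ (lts _) (tsB _) HE) => j.
  by rewrite /te tst (_ : _ == _ = false)//; lia.
- move=> f; have -> : f - Phi (Psi f) = P f - Q0 f.
    rewrite PhiE PsiE (linearD P) (linearB P) (linearD E) (linearB E).
    rewrite PP PD EP ED !subrr !add0r addrK.
    by rewrite opprD addrA opprB [f + _]addrC subrK.
  apply: (tends_ext (u := fun n =>
    \sum_(i < n.*2) ts i f *: t i - \sum_(i < n) ts i.*2 f *: t i.*2)).
    by move=> n; rewrite (sum_even_odd (fun i => ts i f *: t i)) addrC addKr.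
  apply: tendsD; last exact: (tendsN (HQ0 f)).
  by move=> e /(HP f)[n0 H]; exists n0 => n n0n; apply: H; lia.
Qed.
End Ell1System.

(** * Averages over dyadic blocks *)

(** The m-th block consists of the 2^m indices from 2^m - 1 on. *)
Definition block (j : nat) := trunc_log 2 j.+1.
Definition block_start (m : nat) := (2 ^ m).-1.

Lemma block_startS m : block_start m.+1 = (block_start m + 2 ^ m)%N.
Proof. by rewrite /block_start expnS; have := expn_gt0 2 m; lia. Qed.

Lemma le_block_start m n : (m <= n)%N -> (block_start m <= block_start n)%N.
Proof. by move=> mn; rewrite /block_start -!subn1 leq_sub2r// leq_pexp2l. Qed.

Lemma ltn_block_start m : (m < (block_start m).+1)%N.
Proof. by rewrite /block_start prednK ?expn_gt0// ltn_expl. Qed.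

Lemma blockP j m : (block_start m <= j < block_start m.+1)%N = (block j == m).
Proof.
have e n : (2 ^ n = (block_start n).+1)%N by rewrite prednK// expn_gt0.
apply/idP/eqP => [jm|<-].
  by apply: trunc_log_eq => //; rewrite !e !ltnS.
by have := @trunc_log_bounds 2 j.+1 isT isT; rewrite /= !e !ltnS.
Qed.

Lemma sum_blocks (V : nmodType) k (F : nat -> V) :
  \sum_(0 <= j < block_start k) F j =
  \sum_(m < k) \sum_(block_start m <= j < block_start m.+1) F j.
Proof.
elim: k => [|k IH]; first by rewrite big_ord0 big_geq.
by rewrite (big_cat_nat (leq0n _) (le_block_start (leqnSn k))) /= IH big_ord_recr.
Qed.

Lemma sum_in_block (V : nmodType) m (F : nat -> V) (G : nat -> V) :
  (forall j, block j = m -> F j = G j) ->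
  \sum_(block_start m <= j < block_start m.+1) F j =
  \sum_(block_start m <= j < block_start m.+1) G j.
Proof. by move=> FG; apply: eq_big_nat => j; rewrite blockP => /eqP; exact: FG. Qed.

Lemma sum_block_const (V : nmodType) m (c : V) :
  \sum_(block_start m <= j < block_start m.+1) c = c *+ 2 ^ m.
Proof. by rewrite sumr_const_nat block_startS addKn. Qed.

Section Averages.
Context (R : realType) (K : numFieldType) (sk : scalar_field R K).
Context (X : completeNormedModType K).
Local Notation N := (rnorm sk).
Context (q : nat -> X) (qs : nat -> X -> K) (M : R) (sysq : ell1_system sk q qs M).

Definition block_weight m : K := (2 ^ m)%:R^-1.

Lemma block_weight_neq0 m : ((2 ^ m)%:R : K) != 0.
Proof. by rewrite pnatr_eq0 -lt0n expn_gt0. Qed.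

Lemma rnorm_block_weight m : N (block_weight m) = (2 ^ m)%:R^-1.
Proof. by rewrite rnormV ?block_weight_neq0// rnorm_nat. Qed.

Definition block_avg m : X :=
  block_weight m *: \sum_(block_start m <= j < block_start m.+1) q j.
Definition block_sum m f : K := \sum_(block_start m <= j < block_start m.+1) qs j f.

Lemma block_sum_scalar m : scalar (block_sum m).
Proof.
have [[lqs _] _ _] := sysq => a u v; rewrite /block_sum mulr_sumr -big_split.
by apply: eq_bigr => j _; rewrite lqs.
Qed.

Lemma qs_block_avg j m : qs j (block_avg m) = if block j == m then block_weight m else 0.
Proof.
have [[lqs _] qsq _] := sysq.
rewrite scalar_mapZ// scalar_map_sum//.
under eq_bigr do rewrite qsq.
rewrite -blockP; case: ifP => jm; last first.
  rewrite big_nat big1 ?mulr0// => i im; rewrite (_ : (j == i) = false)//.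
  by apply: contraFF jm => /eqP ->.
rewrite (bigD1_seq j) ?mem_index_iota ?iota_uniq//= eqxx big1 ?addr0 ?mulr1// => i.
by rewrite eq_sym => /negbTE ->.
Qed.

Lemma block_sum_q m j : block_sum m (q j) = (block j == m)%:R.
Proof.
have [[lqs _] qsq _] := sysq.
rewrite /block_sum; under eq_bigr do rewrite qsq.
rewrite -blockP; case: (boolP (block_start m <= j < _)%N) => jm; last first.
  rewrite big_nat big1// => i im; rewrite (_ : (i == j) = false)//.
  by apply: contraNF jm => /eqP <-.
rewrite (bigD1_seq j) ?mem_index_iota ?iota_uniq//= eqxx big1 ?addr0// => i.
by move=> /negbTE ->.
Qed.

Lemma block_avg_system : ell1_system sk block_avg block_sum M.
Proof.
have [[lqs sumqs] qsq qM] := sysq; split; first split.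
- exact: block_sum_scalar.
- move=> n f; apply: (@le_trans _ _ (\sum_(0 <= j < block_start n) N (qs j f))).
    rewrite sum_blocks; apply: ler_sum => m _; exact: ler_rnorm_sum.
  by rewrite big_mkord; exact: sumqs.
- move=> i j; rewrite scalar_mapZ; last exact: block_sum_scalar.
  rewrite (scalar_map_sum _ _ (block_sum_scalar i)).
  rewrite (sum_in_block (G := fun=> (i == j)%:R)) => [|l lj]; last first.
    by rewrite block_sum_q lj eq_sym.
  rewrite sum_block_const -[X in _ * X]mulr_natl mulrA /block_weight.
  by rewrite mulVf ?block_weight_neq0 ?mul1r.
- move=> m; rewrite rnormZ rnorm_block_weight ler_pdivrMl ?ltr0n ?expn_gt0//.
  apply: le_trans (ler_rnorm_sum _ _ _ _) _.
  apply: (@le_trans _ _ (\sum_(block_start m <= j < block_start m.+1) M)).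
    by apply: ler_sum => j _.
  by rewrite sum_block_const mulr_natl.
Qed.

(** The functional is the sum of all the [block_sum i], read off the series of the
    vectors [block_sum i f *: q 0], convergent in X, through [qs 0]. *)
Lemma block_functional : exists (c : X -> K) (B : R),
  [/\ scalar c, forall f, N (c f) <= B * N f,
      forall f, (forall i, block_sum i f = 0) -> c f = 0 &
      forall k, c (block_avg k) = 1].
Proof.
have [sumv vv vM] := block_avg_system; have [sumq qsq qM] := sysq.
have M0 : 0 <= M := le_trans (rnorm_ge0 _ _) (qM 0%N).
have [L [HL LB]] := ell1_synthesis (y := fun=> q 0) sumv M0 (fun=> qM 0%N).
exists (fun f => qs 0 (L f)), (M * (M * M)); split.
- by move=> a u v; rewrite linearP; case: sumq => ->.
- move=> f; apply: le_trans (summing_le 0 _ sumq) _; rewrite -mulrA ler_wpM2l//.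
- move=> f f0 /=; have -> : L f = 0 := synthesis_at0 (y := fun=> q 0%N) HL f0.
  by have [lqs _] := sumq; rewrite scalar_map0.
- move=> k /=.
  have -> : L (block_avg k) = q 0.
    exact: (synthesis_at (y := fun=> q 0%N) HL (fun i => vv i k)).
  by rewrite qsq.
Qed.

End Averages.

(** * A conditional almost greedy basis *)

(** Phi, Psi and q are as provided by [ell1_splitting], c by
    [block_functional], and one constant M bounds all the data. *)
Section Construction.
Context (R : realType) (K : numFieldType) (sk : scalar_field R K).
Context (X : completeNormedModType K).
Local Notation N := (rnorm sk).
Context (M : R) (M1 : 1 <= M).
Context (q : nat -> X) (qs : nat -> X -> K) (sysq : ell1_system sk q qs M).
Context (Phi Psi : {linear X -> X})
  (Phi_le : forall f, N (Phi f) <= M * N f) (Psi_le : forall f, N (Psi f) <= M * N f)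
  (Psi_Phi : forall f, Psi (Phi f) = f) (Psi_q : forall i, Psi (q i) = 0)
  (qs_Phi : forall i f, qs i (Phi f) = 0)
  (q_recon : forall f, tends sk (fun n => \sum_(i < n) qs i f *: q i) (f - Phi (Psi f))).
Context (x : nat -> X) (xs : nat -> X -> K)
  (xs_scalar : forall j, scalar (xs j))
  (xs_x : forall i j, xs i (x j) = (i == j)%:R)
  (x_le : forall j, N (x j) <= M)
  (xs_le : forall j f, N (xs j f) <= M * N f)
  (x_sums : forall n f, N (\sum_(i < n) xs i f *: x i) <= M * N f)
  (x_recon : forall f, tends sk (fun n => \sum_(i < n) xs i f *: x i) f).
Local Notation v := (block_avg q).
Local Notation vs := (block_sum qs).
Context (c : X -> K) (c_scalar : scalar c) (c_le : forall f, N (c f) <= M * N f)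
  (c0 : forall f, (forall i, vs i f = 0) -> c f = 0) (c_v : forall k, c (v k) = 1).

Let sysv := block_avg_system sysq.
Let qs_scalar j : scalar (qs j). Proof. by have [[]] := sysq. Qed.
Let vs_scalar j : scalar (vs j). Proof. by have [[]] := sysv. Qed.
Let vs_v i j : vs i (v j) = (i == j)%:R. Proof. by have [] := sysv. Qed.
Let M_ge0 : 0 <= M. Proof. exact: le_trans M1. Qed.

Definition avg_prev k : X := if k is l.+1 then v l else 0.
(** The averages v_k span l1, in which these differences form the conditional
    basis e_0, e_1 - e_0, e_2 - e_1, and so on. *)
Definition avg_diff k : X := v k - avg_prev k.

(** The tail sum of the [vs i f] for i >= k, written with the total sum [c f]
    and a finite sum. *)
Definition diff_coef k f : K := c f - \sum_(i < k) vs i f.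

Definition interlaced n : X := if odd n then avg_diff n./2 else Phi (x n./2).
Definition interlaced_coef n f : K :=
  if odd n then diff_coef n./2 f else xs n./2 (Psi f).
Definition deviation j : X := q j - v (block j).
Definition deviation_coef j f : K := qs j f - block_weight K (block j) * vs (block j) f.
Definition dkk_basis j : X := interlaced (block j) + deviation j.
Definition dkk_coef j f : K :=
  deviation_coef j f + block_weight K (block j) * interlaced_coef (block j) f.

Local Notation w := interlaced.
Local Notation ws := interlaced_coef.
Local Notation u := deviation.
Local Notation us := deviation_coef.
Local Notation b := dkk_basis.
Local Notation bs := dkk_coef.

Lemma vs_Phi i f : vs i (Phi f) = 0.
Proof. by rewrite /block_sum big1// => j _; rewrite qs_Phi. Qed.

Lemma c_Phi f : c (Phi f) = 0.
Proof. by apply: c0 => i; exact: vs_Phi. Qed.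

Lemma Psi_v k : Psi (v k) = 0.
Proof. by rewrite linearZ_LR linear_sum big1 ?scaler0// => j _; rewrite Psi_q. Qed.

Lemma diff_coef_scalar k : scalar (diff_coef k).
Proof.
move=> a f g; rewrite /diff_coef c_scalar.
under eq_bigr do rewrite vs_scalar.
by rewrite big_split /= -mulr_sumr mulrBr opprD addrACA.
Qed.

Lemma interlaced_coef_scalar n : scalar (ws n).
Proof.
rewrite /interlaced_coef; case: (odd n); first exact: diff_coef_scalar.
by move=> a f g; rewrite linearP xs_scalar.
Qed.

Lemma deviation_coef_scalar j : scalar (us j).
Proof.
by move=> a f g; rewrite /deviation_coef qs_scalar vs_scalar; ring.
Qed.

Lemma dkk_coef_scalar j : scalar (bs j).
Proof.
move=> a f g; rewrite /dkk_coef deviation_coef_scalar interlaced_coef_scalar; ring.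
Qed.

Lemma diff_coef_v k l : diff_coef k (v l) = (k <= l)%:R.
Proof.
rewrite /diff_coef c_v; under eq_bigr do rewrite vs_v.
case: leqP => [kl|lk].
  rewrite big1 ?subr0// => i _; rewrite (_ : _ == _ = false)//.
  by have := ltn_ord i; lia.
rewrite (bigD1 (Ordinal lk))//= eqxx big1 ?addr0 ?subrr// => i il.
by rewrite (_ : _ == _ = false)//; apply: contraNF il => /eqP il; apply/eqP/val_inj.
Qed.

Lemma diff_coef_diff k l : diff_coef k (avg_diff l) = (k == l)%:R.
Proof.
have lin := diff_coef_scalar k.
rewrite /avg_diff scalar_mapB// diff_coef_v; case: l => [|l] /=.
  by rewrite scalar_map0// subr0 leqn0.
rewrite diff_coef_v; case: (ltngtP k l.+1) => kl.
- by rewrite (_ : (k <= l)%N)// subrr.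
- by rewrite (_ : (k <= l)%N = false) ?subr0//; lia.
- by rewrite (_ : (k <= l)%N = false) ?subr0//; lia.
Qed.

Lemma interlaced_biorth m n : ws m (w n) = (m == n)%:R.
Proof.
rewrite /interlaced_coef /interlaced.
case: ifPn => om; case: ifPn => on.
- rewrite diff_coef_diff; congr (_%:R); congr (nat_of_bool _).
  apply/eqP/eqP => [|->//]; rewrite -{2}(odd_double_half m) -{2}(odd_double_half n).
  by rewrite om on => ->.
- rewrite /diff_coef c_Phi big1 ?subr0// => [|i _]; last exact: vs_Phi.
  by rewrite (_ : _ == _ = false)//; apply/eqP => mn; rewrite mn (negbTE on) in om.
- rewrite /avg_diff raddfB /= Psi_v.
  have -> : Psi (avg_prev n./2) = 0 by case: (n./2) => [|l] /=; rewrite ?raddf0 ?Psi_v.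
  rewrite subr0 scalar_map0//.
  by rewrite (_ : _ == _ = false)//; apply/eqP => mn; rewrite mn on in om.
- rewrite Psi_Phi xs_x; congr (_%:R); congr (nat_of_bool _).
  apply/eqP/eqP => [|->//]; rewrite -{2}(odd_double_half m) -{2}(odd_double_half n).
  by rewrite (negbTE om) (negbTE on) => ->.
Qed.

Lemma vs_deviation m j : vs m (u j) = 0.
Proof. by rewrite scalar_mapB// (block_sum_q sysq) vs_v eq_sym subrr. Qed.

Lemma Psi_deviation j : Psi (u j) = 0.
Proof. by rewrite linearB Psi_q Psi_v subrr. Qed.

Lemma interlaced_coef_deviation n j : ws n (u j) = 0.
Proof.
rewrite /interlaced_coef; case: ifP => _.
  by rewrite /diff_coef c0 ?big1 ?subrr// => [i _|i]; exact: vs_deviation.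
by rewrite Psi_deviation scalar_map0//.
Qed.

Lemma deviation_coef_v j m : us j (v m) = 0.
Proof.
rewrite /deviation_coef (qs_block_avg sysq) vs_v.
by case: eqP => [->|_]; rewrite ?mulr1 ?mulr0 subrr.
Qed.

Lemma deviation_coef_interlaced j n : us j (w n) = 0.
Proof.
have lin := deviation_coef_scalar j; rewrite /interlaced; case: ifP => _.
  rewrite /avg_diff scalar_mapB// deviation_coef_v sub0r.
  case: (n./2) => [|l] /=; last by rewrite deviation_coef_v oppr0.
  by rewrite scalar_map0// oppr0.
by rewrite /deviation_coef qs_Phi vs_Phi mulr0 subrr.
Qed.

Lemma deviation_coef_deviation i j : us i (u j) =
  (i == j)%:R - block_weight K (block i) * (block i == block j)%:R.
Proof.
rewrite /deviation scalar_mapB; last exact: deviation_coef_scalar.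
rewrite deviation_coef_v subr0 /deviation_coef (block_sum_q sysq).
by have [_ -> _] := sysq; rewrite [block j == _]eq_sym.
Qed.

Lemma dkk_biorth i j : bs i (b j) = (i == j)%:R.
Proof.
have lu := deviation_coef_scalar i; have lw := interlaced_coef_scalar (block i).
rewrite /dkk_coef /dkk_basis (scalar_mapD _ _ lu) (scalar_mapD _ _ lw).
rewrite deviation_coef_interlaced add0r deviation_coef_deviation.
by rewrite interlaced_coef_deviation addr0 interlaced_biorth subrK.
Qed.


Let M_le2 : M <= M ^+ 2.
Proof. by rewrite expr2 ler_peMr. Qed.

Lemma block_avg_le k : N (v k) <= M.
Proof. by have [] := sysv. Qed.

Lemma avg_prev_le k : N (avg_prev k) <= M.
Proof. by case: k => [|k] /=; rewrite ?rnorm0// block_avg_le. Qed.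

Lemma diff_coef_le k f : N (diff_coef k f) <= 2 * M * N f.
Proof.
apply: le_trans (ler_rnormB sk _ _) _; rewrite -mulrA mulrDl mul1r.
apply: lerD (c_le f) _; apply: le_trans (ler_rnorm_sum _ _ _ _) _.
by have [[_ sumv] _ _] := sysv; exact: sumv.
Qed.

Lemma interlaced_coef_le n f : N (ws n f) <= 2 * M ^+ 2 * N f.
Proof.
rewrite /interlaced_coef; case: ifP => _.
  apply: le_trans (diff_coef_le _ _) _.
  by rewrite ler_wpM2r ?rnorm_ge0// ler_wpM2l.
apply: le_trans (xs_le _ _) _.
apply: (@le_trans _ _ (M * (M * N f))); first by rewrite ler_wpM2l.
rewrite mulrA -expr2 ler_wpM2r ?rnorm_ge0//.
by rewrite ler_peMl ?exprn_ge0// ler1n.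
Qed.

Lemma interlaced_le n : N (w n) <= 2 * M ^+ 2.
Proof.
have := M_le2; rewrite /interlaced; case: ifP => _ MM.
  have := ler_rnormB sk (v n./2) (avg_prev n./2).
  rewrite -/(avg_diff _); have := block_avg_le n./2; have := avg_prev_le n./2; lra.
apply: le_trans (Phi_le _) _; apply: (@le_trans _ _ (M * M)).
  by rewrite ler_wpM2l.
by rewrite -expr2 ler_peMl ?exprn_ge0// ler1n.
Qed.

Lemma deviation_le j : N (u j) <= 2 * M.
Proof.
apply: le_trans (ler_rnormB sk _ _) _; rewrite mulrDl mul1r.
by apply: lerD (block_avg_le _); have [] := sysq.
Qed.

Lemma dkk_basis_le j : N (b j) <= 4 * M ^+ 2.
Proof.
apply: le_trans (ler_rnormD sk _ _) _.
have := interlaced_le (block j); have := deviation_le j; have := M_le2; lra.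
Qed.

Lemma block_weight_sum (V : lmodType K) m (y : V) :
  \sum_(block_start m <= j < block_start m.+1) block_weight K m *: y = y.
Proof.
by rewrite sum_block_const -scaler_nat scalerA mulfV ?scale1r// block_weight_neq0.
Qed.

Lemma deviation_coef_sum n f : \sum_(j < n) N (us j f) <= 2 * M * N f.
Proof.
have [[_ sumq] _ _] := sysq; have [[_ sumv] _ _] := sysv.
pose g j := N (block_weight K (block j) * vs (block j) f).
apply: (@le_trans _ _ (\sum_(j < n) (N (qs j f) + g j))).
  by apply: ler_sum => j _; exact: ler_rnormB.
rewrite big_split /= -mulrA mulrDl mul1r; apply: lerD; first exact: sumq.
apply: le_trans (sumv n f).
have nn : (n <= block_start n)%N by have := ltn_block_start n; lia.
apply: (@le_trans _ _ (\sum_(0 <= j < block_start n) g j)).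
  rewrite (big_cat_nat (leq0n n) nn) /= big_mkord lerDl.
  by apply: sumr_ge0 => j _; exact: rnorm_ge0.
rewrite sum_blocks; apply: ler_sum => m _.
rewrite (sum_in_block (G := fun=> N (block_weight K m * vs m f))); last first.
  by move=> j jm; rewrite /g jm.
rewrite sum_block_const rnormM rnorm_block_weight -[X in X <= _]mulr_natl mulrA.
by rewrite divff ?mul1r// pnatr_eq0 -lt0n expn_gt0.
Qed.

Lemma dkk_coef_near j f : N (bs j f - us j f) <= 4 * M ^+ 2 * N f / j.+1%:R.
Proof.
rewrite /dkk_coef addrC addKr rnormM rnorm_block_weight.
rewrite mulrC; have le2 : (2 ^ block j)%:R^-1 <= 2 / j.+1%:R :> R.
  have /andP[_ lt2] := @trunc_log_bounds 2 j.+1 isT isT.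
  rewrite ler_pdivlMr ?ltr0n// ler_pdivrMl ?ltr0n ?expn_gt0//.
  by rewrite -natrM ler_nat -expnSr ltnW.
apply: (@le_trans _ _ (2 * M ^+ 2 * N f * (2 / j.+1%:R))).
  by rewrite ler_pM ?rnorm_ge0 ?invr_ge0//; exact: interlaced_coef_le.
by rewrite le_eqVlt; apply/predU1l; ring.
Qed.

(** Summation by parts. *)
Lemma avg_diff_sum p f : \sum_(i < p) diff_coef i f *: avg_diff i =
  \sum_(i < p) vs i f *: v i + diff_coef p f *: avg_prev p.
Proof.
elim: p => [|p IH]; first by rewrite !big_ord0 scaler0 addr0.
rewrite !big_ord_recr /= IH /avg_diff scalerBr -!addrA; congr (_ + _).
rewrite addrCA subrr addr0 -scalerDl; congr (_ *: _).
by rewrite /diff_coef big_ord_recr /= opprD addrCA [vs p f + _]addrC subrK.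
Qed.

Lemma sum_parity (V : zmodType) (F : nat -> V) n :
  \sum_(i < n) F i = \sum_(i < uphalf n) F i.*2 + \sum_(i < n./2) F i.*2.+1.
Proof.
have gen (o : bool) m : \sum_(i < o + m.*2) F i =
    \sum_(i < o + m) F i.*2 + \sum_(i < m) F i.*2.+1.
  case: o; last exact: sum_even_odd.
  by rewrite !add1n !big_ord_recr /= sum_even_odd addrAC.
by have := gen (odd n) n./2; rewrite odd_double_half uphalf_half.
Qed.

(** The terms of even index form the image under Phi of a partial sum of the
    given basis; those of odd index are summed by parts. *)
Lemma interlaced_sums k f : N (\sum_(m < k) ws m f *: w m) <= 4 * M ^+ 3 * N f.
Proof.
rewrite (sum_parity (fun m => ws m f *: w m)).
have -> : \sum_(i < uphalf k) ws i.*2 f *: w i.*2 =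
    Phi (\sum_(i < uphalf k) xs i (Psi f) *: x i).
  rewrite linear_sum; apply: eq_bigr => i _; rewrite linearZ_LR.
  by rewrite /interlaced_coef /interlaced odd_double doubleK.
have -> : \sum_(i < k./2) ws i.*2.+1 f *: w i.*2.+1 =
    \sum_(i < k./2) diff_coef i f *: avg_diff i.
  apply: eq_bigr => i _; rewrite /interlaced_coef /interlaced /= odd_double /=.
  by rewrite uphalf_double.
rewrite avg_diff_sum; have := M_le2; have M23 : M ^+ 2 <= M ^+ 3.
  by rewrite (exprSr M 2) ler_peMr ?exprn_ge0.
have Nf := rnorm_ge0 sk f.
have e : N (Phi (\sum_(i < uphalf k) xs i (Psi f) *: x i)) <= M ^+ 3 * N f.
  apply: le_trans (Phi_le _) _; rewrite exprS -mulrA ler_wpM2l//.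
  apply: le_trans (x_sums _ _) _; rewrite expr2 -mulrA ler_wpM2l//.
have o1 : N (\sum_(i < k./2) vs i f *: v i) <= M ^+ 2 * N f.
  apply: le_trans (ler_rnorm_sum _ _ _ _) _.
  apply: (@le_trans _ _ (\sum_(i < k./2) M * N (vs i f))).
    by apply: ler_sum => i _; rewrite rnormZ mulrC ler_wpM2r ?rnorm_ge0// block_avg_le.
  by rewrite -mulr_sumr expr2 -mulrA ler_wpM2l//; have [[_ sumv] _ _] := sysv; exact: sumv.
have o2 : N (diff_coef k./2 f *: avg_prev k./2) <= 2 * M ^+ 2 * N f.
  rewrite rnormZ; apply: (@le_trans _ _ (2 * M * N f * M)).
    by rewrite ler_pM ?rnorm_ge0// ?diff_coef_le ?avg_prev_le.
  by rewrite le_eqVlt; apply/predU1l; ring.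
move=> _; apply: le_trans (ler_rnormD sk _ _) _.
have := ler_rnormD sk (\sum_(i < k./2) vs i f *: v i) (diff_coef k./2 f *: avg_prev k./2).
have : M ^+ 2 * N f <= M ^+ 3 * N f by rewrite ler_wpM2r.
by rewrite -!mulrA in e o1 o2 *; lra.
Qed.

Lemma deviation_coef_block_sum m f :
  \sum_(block_start m <= j < block_start m.+1) us j f = 0.
Proof.
rewrite (sum_in_block (G := fun j => qs j f - block_weight K m * vs m f)).
  rewrite sumrB sum_block_const -[X in _ - X]mulr_natl mulrA mulfV ?block_weight_neq0//.
  by rewrite mul1r subrr.
by move=> j jm; rewrite /deviation_coef jm.
Qed.

Lemma deviation_block_sum m : \sum_(block_start m <= j < block_start m.+1) u j = 0.
Proof.
rewrite (sum_in_block (G := fun j => q j - v m)).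
  rewrite sumrB sum_block_const -[X in _ - X]scaler_nat scalerA mulfV ?block_weight_neq0//.
  by rewrite scale1r subrr.
by move=> j jm; rewrite /deviation jm.
Qed.

(** Over a whole block the cross terms vanish, both the deviations and their
    functionals having sum 0. *)
Lemma dkk_block_sum m f :
  \sum_(block_start m <= j < block_start m.+1) bs j f *: b j =
  ws m f *: w m + \sum_(block_start m <= j < block_start m.+1) us j f *: u j.
Proof.
pose a := block_weight K m * ws m f.
rewrite (sum_in_block (G := fun j => (us j f *: w m + us j f *: u j) +
    (block_weight K m *: (ws m f *: w m) + a *: u j))); last first.
  move=> j jm; rewrite /dkk_coef /dkk_basis jm scalerDl !scalerDr.
  by rewrite [block_weight K m *: _]scalerA.
rewrite !big_split /= -scaler_suml -[X in _ + (_ + X)]scaler_sumr.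
rewrite deviation_coef_block_sum scale0r.
by rewrite add0r deviation_block_sum scaler0 addr0 block_weight_sum addrC.
Qed.

(** Whole blocks are handled by [dkk_block_sum].  In the incomplete last block
    the l1 norm of the coefficients is O(|f|). *)
Lemma dkk_sums n f : N (\sum_(i < n) bs i f *: b i) <= 24 * M ^+ 4 * N f.
Proof.
pose k := block n.
have /andP[kn nk] : (block_start k <= n < block_start k.+1)%N by rewrite blockP.
rewrite -(big_mkord xpredT (fun i => bs i f *: b i)) (big_cat_nat (leq0n _) kn) /=.
rewrite sum_blocks (eq_bigr _ (fun (m : 'I_k) _ => dkk_block_sum m f)).
rewrite big_split /= -(sum_blocks k (fun j => us j f *: u j)).
have Nf := rnorm_ge0 sk f.
have p1 := interlaced_sums k f.
have p2 : N (\sum_(0 <= j < block_start k) us j f *: u j) <= 4 * (M ^+ 2 * N f).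
  apply: le_trans (ler_rnorm_sum _ _ _ _) _.
  apply: (@le_trans _ _ (\sum_(0 <= j < block_start k) 2 * M * N (us j f))).
    by apply: ler_sum => j _; rewrite rnormZ mulrC ler_wpM2r ?rnorm_ge0// deviation_le.
  rewrite -mulr_sumr big_mkord; have := deviation_coef_sum (block_start k) f.
  have -> : 4 * (M ^+ 2 * N f) = 2 * M * (2 * M * N f) by ring.
  by move=> H; rewrite ler_wpM2l// mulr_ge0.
have p3 : N (\sum_(block_start k <= j < n) bs j f *: b j) <=
    8 * (M ^+ 3 * N f) + 8 * (M ^+ 4 * N f).
  apply: le_trans (ler_rnorm_sum _ _ _ _) _.
  apply: (@le_trans _ _ (\sum_(block_start k <= j < n)
      4 * M ^+ 2 * (N (us j f) + (2 ^ k)%:R^-1 * (2 * M ^+ 2 * N f)))).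
    rewrite big_nat [leRHS]big_nat; apply: ler_sum => j /andP[kj jn].
    have jk : block j = k by apply/eqP; rewrite -blockP kj (ltn_trans jn).
    rewrite rnormZ mulrC ler_pM ?rnorm_ge0 ?dkk_basis_le//.
    apply: le_trans (ler_rnormD sk _ _) _; rewrite lerD2l jk rnormM rnorm_block_weight.
    by rewrite ler_wpM2l ?invr_ge0// interlaced_coef_le.
  rewrite -mulr_sumr big_split /=.
  have -> : 8 * (M ^+ 3 * N f) + 8 * (M ^+ 4 * N f) =
    4 * M ^+ 2 * (2 * M * N f + 2 * M ^+ 2 * N f) by ring.
  rewrite ler_wpM2l ?mulr_ge0 ?exprn_ge0//; apply: lerD.
    apply: le_trans (deviation_coef_sum n f).
    rewrite -(big_mkord xpredT (fun i => N (us i f))) (big_cat_nat (leq0n _) kn) /=.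
    by rewrite lerDr sumr_ge0// => j _; exact: rnorm_ge0.
  rewrite sumr_const_nat -[X in X <= _]mulr_natl mulrA -[leRHS]mul1r.
  rewrite ler_wpM2r ?mulr_ge0 ?exprn_ge0//.
  rewrite ler_pdivrMr ?ltr0n ?expn_gt0// mul1r ler_nat.
  by rewrite block_startS in nk; lia.
apply: le_trans (ler_rnormD sk _ _) _.
have := ler_rnormD sk (\sum_(m < k) ws m f *: w m)
   (\sum_(0 <= j < block_start k) us j f *: u j).
have m34 : M ^+ 3 * N f <= M ^+ 4 * N f.
  by rewrite ler_wpM2r// (exprSr M 3) ler_peMr ?exprn_ge0.
have m24 : M ^+ 2 * N f <= M ^+ 3 * N f.
  by rewrite ler_wpM2r// (exprSr M 2) ler_peMr ?exprn_ge0.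
by rewrite -!mulrA in p1 *; lra.
Qed.

Definition in_span (g : X) : Prop :=
  exists n (a : nat -> K), g = \sum_(i < n) a i *: b i.

Lemma in_span_widen n m (a : nat -> K) : (n <= m)%N ->
  \sum_(i < n) a i *: b i = \sum_(i < m) (if (i < n)%N then a i else 0) *: b i.
Proof.
move=> nm; rewrite (big_ord_widen _ (fun i => a i *: b i) nm) big_mkcond.
by apply: eq_bigr => i _; case: ifP => //; rewrite scale0r.
Qed.

Lemma in_spanD g h : in_span g -> in_span h -> in_span (g + h).
Proof.
move=> [n [a ->]] [m [a' ->]].
rewrite (in_span_widen a (leq_maxl n m)) (in_span_widen a' (leq_maxr n m)).
exists (maxn n m),
  (fun i => (if (i < n)%N then a i else 0) + (if (i < m)%N then a' i else 0)).
by rewrite -big_split; apply: eq_bigr => i _; rewrite scalerDl.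
Qed.

Lemma in_spanZ k g : in_span g -> in_span (k *: g).
Proof.
move=> [n [a ->]]; exists n, (fun i => k * a i); rewrite scaler_sumr.
by apply: eq_bigr => i _; rewrite scalerA.
Qed.

Lemma in_span0 : in_span 0.
Proof. by exists 0%N, (fun=> 0); rewrite big_ord0. Qed.

Lemma in_span_sum I (r : seq I) (F : I -> X) :
  (forall i, in_span (F i)) -> in_span (\sum_(i <- r) F i).
Proof.
move=> HF; elim: r => [|i r IH]; first by rewrite big_nil; exact: in_span0.
by rewrite big_cons; exact: in_spanD.
Qed.

Lemma in_span_basis j : in_span (b j).
Proof.
exists j.+1, (fun i => (i == j)%:R); rewrite big_ord_recr /= eqxx scale1r.
rewrite big1 ?add0r// => i _; rewrite (_ : _ == _ = false) ?scale0r//.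
by have := ltn_ord i; lia.
Qed.

Lemma interlaced_block_avg m :
  w m = block_weight K m *: \sum_(block_start m <= j < block_start m.+1) b j.
Proof.
rewrite (sum_in_block (G := fun j => w m + u j)) => [|j jm].
  by rewrite big_split /= deviation_block_sum addr0 scaler_sumr block_weight_sum.
by rewrite /dkk_basis jm.
Qed.

Lemma in_span_interlaced m : in_span (w m).
Proof.
by rewrite interlaced_block_avg; apply/in_spanZ/in_span_sum => j; exact: in_span_basis.
Qed.

Lemma in_span_avg k : in_span (v k).
Proof.
have wE l : w l.*2.+1 = avg_diff l by rewrite /interlaced /= odd_double /= uphalf_double.
elim: k => [|k IH].
  have -> : v 0 = w 1%N by rewrite (wE 0%N) /avg_diff subr0.
  exact: in_span_interlaced.
have -> : v k.+1 = w k.+1.*2.+1 + v k by rewrite wE /avg_diff subrK.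
by apply: in_spanD => //; exact: in_span_interlaced.
Qed.

Lemma in_span_q j : in_span (q j).
Proof.
have -> : q j = b j - w (block j) + v (block j).
  by rewrite /dkk_basis [w _ + _]addrC addrK subrK.
apply: in_spanD (in_span_avg _); apply: in_spanD (in_span_basis j) _.
by rewrite -scaleN1r; apply/in_spanZ/in_span_interlaced.
Qed.

Lemma dkk_total f (e : R) : 0 < e ->
  exists n (a : nat -> K), N (f - \sum_(i < n) a i *: b i) < e.
Proof.
move=> e0; have e2 : 0 < e / 2 by rewrite divr_gt0.
have [n1 H1] := bounded_tends Phi_le (x_recon (Psi f)) e2.
have [n2 H2] := q_recon f e2.
set g1 := Phi _ in H1; pose g := Phi (\sum_(i < n1) xs i (Psi f) *: x i) +
  \sum_(i < n2) qs i f *: q i.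
have [n [a ga]] : in_span g.
  apply: in_spanD; last by apply: in_span_sum => i; apply/in_spanZ/in_span_q.
  rewrite linear_sum; apply: in_span_sum => i; rewrite linearZ_LR; apply: in_spanZ.
  have -> : Phi (x i) = w i.*2 by rewrite /interlaced odd_double doubleK.
  exact: in_span_interlaced.
exists n, a; rewrite -ga; have {}H1 := H1 _ (leqnn n1); have {}H2 := H2 _ (leqnn n2).
rewrite rnorm_distC /g.
set A := Phi _ in H1 *; set B := \sum_(i < n2) _ in H2 *.
have -> : A + B - f = (A - g1) + (B - (f - g1)).
  by rewrite opprB addrCA -addrA [_ + (g1 - f)]addrA subrK addrCA addrA.
by apply: le_lt_trans (ler_rnormD sk _ _) _; move: H1 H2; lra.
Qed.

Lemma interlaced_coef_v m k : ws m (v k) = (odd m && (m./2 <= k)%N)%:R.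
Proof.
rewrite /interlaced_coef; case: ifP => _ /=; first exact: diff_coef_v.
by rewrite Psi_v scalar_map0//.
Qed.

Lemma dkk_coef_v j k : bs j (v k) != 0 -> (j < 4 ^ k.+1)%N.
Proof.
rewrite /dkk_coef deviation_coef_v add0r interlaced_coef_v.
case: (boolP (odd _ && _)) => [/andP[om mk] _|_]; last by rewrite mulr0 eqxx.
have /andP[_ lt_j] : (block_start (block j) <= j < block_start (block j).+1)%N.
  by rewrite blockP.
have bk : ((block j).+1 <= k.+1.*2)%N.
  by rewrite -(odd_double_half (block j)) om; lia.
have := leq_trans lt_j (le_block_start bk).
rewrite /block_start -mul2n expnM => /leq_trans; apply; exact: leq_pred.
Qed.

(** The blocks of the differences v_l - v_(l-1) with l even. *)
Definition alternate_block (m : nat) := odd m && ~~ odd m./2.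

Lemma alternate_projection k :
  \sum_(j < 4 ^ k.+1 | alternate_block (block j)) bs j (v k) *: b j =
  \sum_(m < k.+1.*2) (if alternate_block m then ws m (v k) *: w m else 0).
Proof.
have e4 : (4 ^ k.+1 = (block_start k.+1.*2).+1)%N.
  by rewrite /block_start -mul2n expnM prednK ?expn_gt0.
pose F j := if alternate_block (block j) then bs j (v k) *: b j else 0.
have F_last : F (block_start k.+1.*2) = 0.
  have /eqP blk : block (block_start k.+1.*2) == k.+1.*2.
    by rewrite -blockP leqnn /= block_startS -[ltnLHS]addn0 ltn_add2l expn_gt0.
  by rewrite /F /alternate_block blk odd_double.
rewrite e4 big_mkcond -/(\sum_(i < (block_start k.+1.*2).+1) F i) big_ord_recr /= F_last addr0.
rewrite -(big_mkord xpredT F) sum_blocks; apply: eq_bigr => m _.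
rewrite (sum_in_block (G := fun j => if alternate_block m then bs j (v k) *: b j else 0)).
  case: ifP => _; last by rewrite big1.
  rewrite dkk_block_sum big1 ?addr0// => j _.
  by rewrite deviation_coef_v scale0r.
by move=> j jm; rewrite /F jm.
Qed.

Lemma vs_avg_diff_even i l : ~~ odd i -> ~~ odd l -> vs i (avg_diff l) = (i == l)%:R.
Proof.
move=> oi ol; rewrite scalar_mapB// vs_v; case: l ol => [|l] /= ol.
  by rewrite scalar_map0// subr0.
rewrite vs_v (_ : (i == l) = false) ?subr0//.
by apply/eqP => il; move: oi; rewrite il; move: ol; rewrite negbK => ->.
Qed.

Lemma vs_alternate_projection k i : (i <= k)%N -> ~~ odd i ->
  vs i (\sum_(j < 4 ^ k.+1 | alternate_block (block j)) bs j (v k) *: b j) = 1.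
Proof.
move=> ik oi; rewrite alternate_projection scalar_map_sum//.
have i2 : (i.*2.+1 < k.+1.*2)%N by lia.
rewrite (bigD1 (Ordinal i2))//= big1 ?addr0 => [|m mi].
  rewrite /alternate_block /= odd_double /= uphalf_double oi scalar_mapZ//.
  rewrite interlaced_coef_v /= odd_double uphalf_double ik mul1r.
  by rewrite /interlaced /= odd_double /= uphalf_double vs_avg_diff_even// eqxx.
case: ifP => [/andP[om ohm]|_]; last by rewrite scalar_map0//.
rewrite scalar_mapZ// /interlaced om vs_avg_diff_even//.
rewrite (_ : _ == _ = false) ?mulr0//; apply: contraNF mi => /eqP im.
by apply/eqP/val_inj; rewrite /= im -{1}(odd_double_half m) om.
Qed.

(** For v_k the projection on the alternate blocks is the sum of the v_l - v_(l-1)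
    with l <= k even, and each average of even index occurs once in it. *)
Lemma dkk_alternating n : (0 < n)%N -> exists f (P : pred nat),
  [/\ f != 0, forall j, bs j f != 0 -> (j < 4 ^ n)%N &
    (2 * M ^+ 2)^-1 * n%:R * N f <= N (\sum_(j < 4 ^ n | P j) bs j f *: b j)].
Proof.
case: n => // k _; exists (v k), (fun j => alternate_block (block j)); split.
- apply/eqP => vk0; have := vs_v k k; rewrite vk0 eqxx.
  rewrite scalar_map0// => /eqP.
  by rewrite eq_sym oner_eq0.
- by move=> j; exact: dkk_coef_v.
set g := \sum_(j < _ | _) _.
have M0 : 0 < M by apply: lt_le_trans M1.
have [[_ sumv] _ _] := sysv; have := sumv k.+1 g.
have half : k.+1%:R / 2 <= \sum_(i < k.+1) N (vs i g).
  apply: (@le_trans _ _ (\sum_(i < k.+1) (~~ odd i)%:R)); last first.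
    apply: ler_sum => i _; case: (boolP (odd i)) => oi /=; first exact: rnorm_ge0.
    by rewrite vs_alternate_projection ?rnorm1// -ltnS.
  rewrite ler_pdivrMr// -natr_sum -natrM ler_nat.
  suff -> : (\sum_(i < k.+1) ~~ odd i = uphalf k.+1)%N by rewrite uphalf_half; lia.
  elim: k.+1 => [|m IH]; first by rewrite big_ord0.
  by rewrite big_ord_recr /= IH uphalf_half; case: (odd m) => /=; lia.
move=> /(le_trans half) le_g.
apply: (@le_trans _ _ ((2 * M ^+ 2)^-1 * k.+1%:R * M)).
  by rewrite ler_wpM2l ?block_avg_le// mulr_ge0// invr_ge0 mulr_ge0 ?exprn_ge0.
have -> : (2 * M ^+ 2)^-1 * k.+1%:R * M = M^-1 * (k.+1%:R / 2).
  by field; rewrite gt_eqF.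
by rewrite ler_pdivrMl.
Qed.

Lemma dkk_basis_properties :
  [/\ banach_basis sk b, almost_greedy sk b,
      equivalent_on [set m | (1 <= m)%N]
        (fundamental_function sk b) (fun m => (m%:R)%:E) &
      equivalent_on [set m | (2 <= m)%N]
        (lebesgue_type_L sk b) (fun m => (ln m%:R)%:E)].
Proof.
have M24 : M ^+ 2 <= M ^+ 4 by rewrite ler_weXn2l.
have M14 : M <= M ^+ 4 by rewrite -[leLHS]expr1 ler_weXn2l.
have c0' : 0 < (2 * M ^+ 2)^-1.
  by rewrite invr_gt0 mulr_gt0// exprn_gt0// (lt_le_trans ltr01).
have bC j : N (b j) <= 24 * M ^+ 4.
  by apply: le_trans (dkk_basis_le j) _; rewrite ler_pM ?exprn_ge0// ler_nat.
have usC n f : \sum_(i < n) N (us i f) <= 24 * M ^+ 4 * N f.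
  apply: le_trans (deviation_coef_sum n f) _.
  by rewrite ler_wpM2r ?rnorm_ge0// ler_pM// ler_nat.
have nearC j f : N (bs j f - us j f) <= 24 * M ^+ 4 * N f / j.+1%:R.
  apply: le_trans (dkk_coef_near j f) _.
  by rewrite ler_wpM2r ?invr_ge0// ler_wpM2r ?rnorm_ge0// ler_pM ?exprn_ge0// ler_nat.
exact: (near_ell1_basis dkk_coef_scalar dkk_biorth dkk_total dkk_sums bC usC nearC c0'
  dkk_alternating).
Qed.
End Construction.

(** * From a complemented subspace to the theorem *)

Section FromIsomorphism.
Context (R : realType) (K : numFieldType) (sk : scalar_field R K).
Context (X : completeNormedModType K).
Local Notation N := (rnorm sk).

Lemma rnorm_ell1 (a : ell1 sk) : N a = fine (ell1_norm sk a).
Proof. exact: scalar_of_realK. Qed.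

Lemma ell1_partial_sum_le (a : ell1 sk) n : \sum_(i < n) N (ell1_val a i) <= N a.
Proof.
rewrite rnorm_ell1 -lee_fin fineK ?ell1_fin_num// -sumEFin /ell1_norm.
rewrite -(big_mkord xpredT (fun i => (N (ell1_val a i))%:E)).
by apply: nneseries_lim_ge => i _ _; rewrite lee_fin rnorm_ge0.
Qed.

Lemma ell1_unit_pred i : (fun j => (j == i)%:R : K) \in ell1_pred sk.
Proof.
apply/asboolP; rewrite /ell1_norm (nneseriesD1 (n := i))//; last first.
  by move=> j _; rewrite lee_fin rnorm_ge0.
rewrite eqxx rnorm1 eseries0 ?adde0 ?ltry// => j _ /negbTE ->.
by rewrite rnorm0.
Qed.

Definition ell1_unit i : ell1 sk := Ell1 (ell1_unit_pred i).

Lemma rnorm_ell1_unit i : N (ell1_unit i) = 1.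
Proof.
rewrite rnorm_ell1 /ell1_norm (nneseriesD1 (n := i))//=; last first.
  by move=> j _; rewrite lee_fin rnorm_ge0.
by rewrite eqxx rnorm1 eseries0 ?adde0// => j _ /negbTE ->; rewrite rnorm0.
Qed.

Lemma continuous_linear_le (P : {linear X -> X}) : continuous P ->
  exists2 B : R, 0 <= B & forall f, N (P f) <= B * N f.
Proof.
move=> /(_ 0); rewrite /continuous_at raddf0 => /cvgrPdistC_lt /(_ _ ltr01).
rewrite -nbhs_ballE => -[_ /= /(pos_scalar_of_real sk)[d d0 ->] Pd].
have {}Pd f : N f < d -> N (P f) < 1.
  move=> fd; have := Pd f; rewrite -ball_normE /= sub0r normrN subr0.
  rewrite -!(rnormK sk) -[in _ < 1](scalar_of_real_eq1 sk) !ltr_scalar_of_real.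
  exact.
exists (2 / d); first by rewrite divr_ge0// ltW.
move=> f; have [->|f0] := eqVneq f 0; first by rewrite raddf0 rnorm0 mulr0.
have Nf : 0 < N f by rewrite rnorm_gt0.
pose s := d / (2 * N f); have s0 : 0 < s by rewrite divr_gt0// mulr_gt0.
have := Pd (scalar_of_real sk s *: f); rewrite linearZ_LR !rnormZ rnorm_of_real ?(ltW s0)//.
have -> : s * N f = d / 2 by rewrite /s; field; rewrite gt_eqF.
rewrite ltr_pdivrMr// ltr_pMr// ltr1n => /(_ isT).
rewrite -ltr_pdivlMl// mulr1 /s invf_div => /ltW/le_trans; apply.
by rewrite le_eqVlt; apply/predU1l; field; rewrite gt_eqF.
Qed.

Lemma rnorm_norm (V : normedZmodType K) (f : V) : N (`|f| : K) = N f.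
Proof. by rewrite /rnorm normr_id. Qed.

Lemma ler_rnorm (k l : K) : 0 <= k -> k <= l -> N k <= N l.
Proof.
by move=> k0 kl; rewrite -ler_rnorm_norm !ger0_norm// (le_trans k0 kl).
Qed.

(** The functionals are the coordinates of T^-1 P, the vectors the images under
    T of the unit vectors. *)
Lemma complemented_ell1_system (Y : set X) :
  complemented Y -> isomorphic_onto (ell1 sk) Y ->
  exists t ts (M : R), ell1_system sk t (ts : nat -> X -> K) M.
Proof.
move=> [P [Pcont PP rP]] [T [rT [c [C [c0 HT]]]]].
have [B B0 PB] := continuous_linear_le Pcont.
have Nc0 : 0 < N c by rewrite rnorm_gt0 gt_eqF.
have Tlow a : N a <= (N c)^-1 * N (T a).
  have /andP[+ _] := HT a => /ler_rnorm; rewrite rnormM !rnorm_norm.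
  by rewrite ler_pdivlMl//; apply; rewrite mulr_ge0// ltW.
have Tup a : N (T a) <= N C * N a.
  by have /andP[_ /ler_rnorm] := HT a; rewrite rnormM !rnorm_norm; apply.
have Tinj a a' : T a = T a' -> a = a'.
  move=> Taa; apply/eqP; rewrite -subr_eq0; apply/eqP/(@rnorm_eq0 _ _ sk)/eqP.
  rewrite eq_le rnorm_ge0 andbT; have := Tlow (a - a').
  by rewrite linearB Taa subrr rnorm0 mulr0.
have /choice[S TS] f : exists a, T a = P f.
  by have : range T (P f) by [rewrite rT -rP; exists f]; move=> [a _ <-]; exists a.
have PT a : P (T a) = T a.
  by have : range P (T a) by [rewrite rP -rT; exists a]; move=> [f _ <-]; rewrite PP.
have ST a : S (T a) = a by apply: Tinj; rewrite TS PT.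
have S_lin k f g : S (k *: f + g) = k *: S f + S g.
  by apply: Tinj; rewrite linearP !TS linearP.
pose ts i f := ell1_val (S f) i.
exists (fun i => T (ell1_unit i)), ts, (Num.max (N C) ((N c)^-1 * B)); split; first split.
- by move=> i k f g; rewrite /ts S_lin.
- move=> n f; apply: le_trans (ell1_partial_sum_le _ _) _.
  apply: le_trans (Tlow _) _; rewrite TS.
  apply: (@le_trans _ _ ((N c)^-1 * B * N f)).
    by rewrite -mulrA ler_wpM2l ?invr_ge0 ?rnorm_ge0.
  by rewrite ler_wpM2r ?rnorm_ge0// le_max lexx orbT.
- by move=> i j; rewrite /ts ST.
- move=> i; apply: le_trans (Tup _) _; rewrite rnorm_ell1_unit mulr1.
  by rewrite le_max lexx.
Qed.
End FromIsomorphism.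

Lemma ell1_system_weaken (R : realType) (K : numFieldType) (sk : scalar_field R K)
    (X : completeNormedModType K) (q : nat -> X) (qs : nat -> X -> K) (M M' : R) :
  M <= M' -> ell1_system sk q qs M -> ell1_system sk q qs M'.
Proof.
move=> MM [[lqs sqs] qq qM]; split=> //; last by move=> i; apply: le_trans MM.
by split=> // n f; apply: le_trans (sqs n f) _; rewrite ler_wpM2r ?rnorm_ge0.
Qed.

(** The infimum and the supremum of the norms are finite and positive, so
    bounded partial sums give bounded coordinate functionals. *)
Lemma banach_basis_bounds (R : realType) (K : numFieldType) (sk : scalar_field R K)
    (X : completeNormedModType K) (x : nat -> X) : banach_basis sk x ->
  exists M : R, [/\ forall i j, coordinate x i (x j) = (i == j)%:R,
    forall j, rnorm sk (x j) <= M,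
    forall j f, rnorm sk (coordinate x j f) <= M * rnorm sk f &
    forall n f, rnorm sk (\sum_(i < n) coordinate x i f *: x i) <= M * rnorm sk f].
Proof.
move=> [sx [xinf xsup]].
have [d d0 dx] : exists2 d : R, 0 < d & forall j, d <= rnorm sk (x j).
  move: xinf; set I := ereal_inf _ => I0.
  have Ile j : (I <= (rnorm sk (x j))%:E)%E by apply: ereal_inf_lbound; exists j.
  have fI : I \is a fin_num.
    rewrite fin_numE gt_eqF/=; last exact: lt_trans I0.
    by apply/eqP => Ioo; have := Ile 0%N; rewrite Ioo.
  exists (fine I); first by rewrite fine_gt0// I0 ltey_eq fI.
  by move=> j; rewrite -lee_fin fineK.
have [D Dx] : exists D : R, forall j, rnorm sk (x j) <= D.
  move: xsup; set I := ereal_sup _ => Ioo.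
  have Ige j : ((rnorm sk (x j))%:E <= I)%E by apply: ereal_sup_ubound; exists j.
  have fI : I \is a fin_num.
    rewrite fin_numE (lt_eqF Ioo) andbT.
    by apply/eqP => I0; have := Ige 0%N; rewrite I0.
  by exists (fine I) => j; rewrite -lee_fin fineK.
have x0 j : x j != 0 by rewrite -(rnorm_gt0 sk) (lt_le_trans d0).
have [M HM] := schauder_partial_sums_bounded sk sx x0.
have M0 : 0 <= M.
  have := le_trans (rnorm_ge0 _ _) (HM 0%N (x 0%N)).
  by rewrite pmulr_lge0// rnorm_gt0.
exists (Num.max D (Num.max M (2 * M / d))); split.
- move=> i j; rewrite (@coordinate_unique _ _ x sx _ (fun i => (i == j)%:R))//.
  apply/(expansion_tends sk) => e e0; exists j.+1 => n jn.
  rewrite (bigD1 (Ordinal jn))//= eqxx scale1r big1 ?addr0 ?subrr ?rnorm0// => k kj.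
  rewrite (_ : _ == _ = false) ?scale0r//.
  by apply: contraNF kj => /eqP kj; apply/eqP/val_inj.
- by move=> j; rewrite le_max Dx.
- move=> j f; apply: (@le_trans _ _ (2 * M / d * rnorm sk f)).
    rewrite mulrAC ler_pdivlMr//.
    apply: (@le_trans _ _ (rnorm sk (coordinate x j f) * rnorm sk (x j))).
      by rewrite ler_wpM2l ?rnorm_ge0.
    rewrite -rnormZ.
    have -> : coordinate x j f *: x j = \sum_(i < j.+1) coordinate x i f *: x i -
                                       \sum_(i < j) coordinate x i f *: x i.
      by rewrite big_ord_recr /= [X in X - _]addrC addrK.
    apply: le_trans (ler_rnormB sk _ _) _; rewrite -mulrA mulrDl mul1r.
    by apply: lerD; exact: HM.
  by rewrite ler_wpM2r ?rnorm_ge0// !le_max lexx !orbT.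
- move=> n f; apply: le_trans (HM n f) _.
  by rewrite ler_wpM2r ?rnorm_ge0// !le_max lexx !orbT.
Qed.

Theorem theorem4p14 (R : realType) (K : numFieldType) (sk : scalar_field R K)
    (X : completeNormedModType K) :
  (exists x : nat -> X, banach_basis sk x) ->
  (exists Y : set X, complemented Y /\ isomorphic_onto (ell1 sk) Y) ->
  exists x : nat -> X,
    [/\ banach_basis sk x,
        almost_greedy sk x,
        equivalent_on [set m | (1 <= m)%N]
          (fundamental_function sk x) (fun m => (m%:R)%:E) &
        equivalent_on [set m | (2 <= m)%N]
          (lebesgue_type_L sk x) (fun m => (ln m%:R)%:E)].
Proof.
move=> [x bx] [Y [cY iY]].
have [t [ts [Mt syst]]] := complemented_ell1_system cY iY.
have [Mx [xs_x x_le xs_le x_sums]] := banach_basis_bounds bx.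
have [sx _] := bx.
have [Phi [Psi [q [qs [B [[PhiB PsiB] sysq Psi_Phi [Psi_q qs_Phi] recon]]]]]] :=
  ell1_splitting syst.
have [c [Mc [c_scalar c_le c0 cv]]] := block_functional sysq.
pose M : R := Num.max 1 (Num.max Mt (Num.max Mx (Num.max B Mc))).
have M1 : 1 <= M by rewrite le_max lexx.
have Mt_le : Mt <= M by rewrite !le_max lexx !orbT.
have Mx_le : Mx <= M by rewrite !le_max lexx !orbT.
have B_le : B <= M by rewrite !le_max lexx !orbT.
have Mc_le : Mc <= M by rewrite !le_max lexx !orbT.
have le_M (a r s : R) : 0 <= s -> a <= M -> r <= a * s -> r <= M * s.
  by move=> s0 aM /le_trans; apply; rewrite ler_wpM2r.
have sysM := ell1_system_weaken Mt_le sysq.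
pose xs j f := coordinate x j f.
have xs_scalar j : scalar (xs j) := coordinate_linear sk sx j.
have x_recon f : tends sk (fun n => \sum_(i < n) xs i f *: x i) f.
  exact/(expansion_tends sk)/coordinate_expansion.
have Phi_le f : rnorm sk (Phi f) <= M * rnorm sk f.
  exact: le_M (rnorm_ge0 _ _) B_le (PhiB f).
have Psi_le f : rnorm sk (Psi f) <= M * rnorm sk f.
  exact: le_M (rnorm_ge0 _ _) B_le (PsiB f).
have {}x_le j : rnorm sk (x j) <= M := le_trans (x_le j) Mx_le.
have {}xs_le j f : rnorm sk (xs j f) <= M * rnorm sk f.
  exact: le_M (rnorm_ge0 _ _) Mx_le (xs_le j f).
have {}x_sums n f : rnorm sk (\sum_(i < n) xs i f *: x i) <= M * rnorm sk f.
  exact: le_M (rnorm_ge0 _ _) Mx_le (x_sums n f).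
have {}c_le f : rnorm sk (c f) <= M * rnorm sk f.
  exact: le_M (rnorm_ge0 _ _) Mc_le (c_le f).
exists (dkk_basis q Phi x).
exact: (dkk_basis_properties M1 sysM Phi_le Psi_le Psi_Phi Psi_q qs_Phi recon
  xs_scalar xs_x x_le xs_le x_sums x_recon c_scalar c_le c0 cv).
Qed.
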